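(* Let $G$ be a unicyclic graph of order $n\ge 3$. Then $\lambda(G)\leq \lambda(Ki_{n,3})$, with equality if and only if $G\cong Ki_{n,3}$.
   Context: All graphs are finite, simple and undirected. The order of a graph is its number of vertices. A unicyclic graph is a connected graph containing exactly one cycle. For a connected graph $G$ with vertex set $V(G)$, $d_G(u,v)$ denotes the length of a shortest path from $u$ to $v$ in $G$, and the distance matrix is $D(G)=(d_G(u,v))_{u,v\in V(G)}$. The transmission of $u\in V(G)$ is $Tr_G(u)=\sum_{v\in V(G)}d_G(u,v)$, and $Tr(G)$ is the diagonal matrix of vertex transmissions of $G$. The distance Laplacian matrix of $G$ is $\mathcal{L}(G)=Tr(G)-D(G)$ (a real symmetric positive semidefinite matrix). The distance Laplacian spectral radius $\lambda(G)$ is the largest eigenvalue of $\mathcal{L}(G)$. For $n\ge 4$, $Ki_{n,3}$ is the graph on $n$ vertices obtained from the disjoint union of a triangle and a path on $n-3$ vertices by adding an edge between a vertex of the triangle and a terminal vertex of the path (for $n=4$ the path is a single vertex). For $n=3$, $Ki_{3,3}$ is the triangle. *)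

(* Defs.v *)
From HB Require Import structures.
From mathcomp Require Import all_boot all_order all_algebra.
From mathcomp Require Import all_classical reals.

Set Implicit Arguments.
Unset Strict Implicit.
Unset Printing Implicit Defensive.

Import Order.TTheory GRing.Theory Num.Theory.

Local Open Scope ring_scope.

(* A graph is a finite type of vertices with a symmetric irreflexive adjacency
   relation. *)
Section Graphs.
Variable T : finType.
Implicit Types (e : rel T) (u v : T).

Definition simple_graph e : Prop := symmetric e /\ irreflexive e.

Definition connected_graph e : Prop :=
  (0 < #|T|)%N /\ forall u v, connect e u v.

(* Cycles are counted as subgraphs, which have no isolated vertices and are
   therefore identified with their edge sets: rotating or reversing the vertex
   sequence [s] does not give a new cycle. *)
Definition is_cycle e (C : {set {set T}}) : Prop :=
  exists s : seq T,
    [/\ ucycle e s, (2 < size s)%N & C = [set [set x; next s x] | x in s]].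

Definition unicyclic e : Prop :=
  connected_graph e /\ exists! C : {set {set T}}, is_cycle e C.

Definition has_path_of_length e u v (k : nat) : bool :=
  [exists p : k.-tuple T, [&& path e u p, uniq (u :: p) & last u p == v]].

(* [find] returns the least admissible length; a path on distinct vertices has
   length less than [#|T|], so the search range is exhaustive. The value is
   [#|T|] when [u] and [v] are not connected. *)
Definition gdist e u v : nat := find (has_path_of_length e u v) (iota 0 #|T|).

Definition transmission e u : nat := (\sum_(v : T) gdist e u v)%N.

End Graphs.

Section DistanceLaplacian.
Variables (R : realType) (T : finType).
Implicit Type e : rel T.

Definition dist_mx e : 'M[R]_#|T| :=
  \matrix_(i, j) (gdist e (enum_val i) (enum_val j))%:R.

Definition trans_mx e : 'M[R]_#|T| :=
  diag_mx (\row_i (transmission e (enum_val i))%:R).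

Definition dist_lap e : 'M[R]_#|T| := trans_mx e - dist_mx e.

(* On a nonempty graph this supremum is a maximum: see [dist_lap_radiusP]. *)
Definition dist_lap_radius e : R := sup [set a : R | eigenvalue (dist_lap e) a].

End DistanceLaplacian.

Definition isomorphic (T T' : finType) (e : rel T) (e' : rel T') : Prop :=
  exists2 f : T -> T', bijective f & forall x y, e' (f x) (f y) = e x y.

(* The triangle is {0, 1, 2}, the path is 3, 4, ..., n - 1, and the edge joining
   them is {2, 3}; the last two are both covered by consecutive numbers. *)
Definition kite3 (n : nat) : rel 'I_n := fun i j =>
  (i != j) && [|| (i < 3)%N && (j < 3)%N, i.+1 == j :> nat | j.+1 == i :> nat].

Section Largest.
Variables (R : realType) (T : finType).
Implicit Type e : rel T.

Lemma gdistC e : symmetric e -> forall u v, gdist e u v = gdist e v u.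
Proof.
move=> es u v; apply: eq_find => k.
suff {u v} H u v : has_path_of_length e u v k -> has_path_of_length e v u k.
  by apply/idP/idP; exact: H.
case/existsP=> p /and3P[pp up /eqP lp].
have sz : size (rev (belast u p)) == k by rewrite size_rev size_belast size_tuple.
apply/existsP; exists (Tuple sz) => /=.
have E : v :: rev (belast u p) = rev (u :: p).
  by rewrite [u :: p]lastI rev_rcons lp.
apply/and3P; split.
- rewrite -lp rev_path; apply: sub_path pp => x y; by rewrite es.
- by have := up; rewrite -(rev_uniq (u :: p)) -E.
- have := congr1 (last u) E; rewrite /= => ->.
  by rewrite rev_cons last_rcons.
Qed.

Lemma dist_lap_radiusP e : symmetric e -> (0 < #|T|)%N ->
  eigenvalue (dist_lap R e) (dist_lap_radius R e) /\
  forall a, eigenvalue (dist_lap R e) a -> a <= dist_lap_radius R e.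
Proof.
move=> es T0; set A := dist_lap R e.
have A0 : eigenvalue A 0.
  apply/eigenvalueP; exists (const_mx 1).
    rewrite scale0r; apply/rowP => j; rewrite !mxE.
    under eq_bigr => i _ do rewrite !mxE mul1r.
    rewrite big_split /= (bigD1 j) //= eqxx mulr1n big1 ?addr0; last first.
      by move=> i /negbTE ij; rewrite ij mulr0n.
    rewrite sumrN /transmission natr_sum (reindex_onto enum_val enum_rank) /=;
      last by move=> i _; rewrite enum_rankK.
    apply/eqP; rewrite subr_eq0; apply/eqP; apply: eq_big => [i|i _].
      by rewrite enum_valK eqxx.
    by rewrite gdistC.
  apply/eqP => /rowP /(_ (Ordinal T0)); rewrite !mxE => /eqP.
  by rewrite oner_eq0.
have nz : char_poly A != 0 by exact/monic_neq0/char_poly_monic.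
have bnd (s : seq R) : uniq s -> all (root (char_poly A)) s ->
    (size s < size (char_poly A))%N.
  by move=> us rs; apply: max_poly_roots.
(* a finite nonempty set of reals has a maximum *)
have [m mA mmax] : exists2 m, eigenvalue A m &
    forall a, eigenvalue A a -> a <= m.
  apply: contrapT => H.
  have step a : eigenvalue A a -> exists2 b, eigenvalue A b & a < b.
    move=> Aa; apply: contrapT => H'; apply: H; exists a => // b Ab.
    by rewrite leNgt; apply/negP => ab; apply: H'; exists b.
  have chain k : exists s : seq R, [/\ size s = k.+1, all (eigenvalue A) s &
      sorted >%R s].
    elim: k => [|k [[|a s] [//= [sz] /andP[Aa As] ss]]].
      by exists [:: 0]; split; rewrite //= A0.
    have [b Ab ab] := step _ Aa.
    by exists [:: b, a & s]; split; rewrite /= ?sz ?Ab ?Aa ?ab.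
  have [s [sz As ss]] := chain (size (char_poly A)).
  have us : uniq s.
    by apply: sorted_uniq ss => [x y z /= h1 h2|x /=]; rewrite ?ltxx // (lt_trans h2).
  have rs : all (root (char_poly A)) s.
    by apply: sub_all As => x; rewrite eigenvalue_root_char.
  by have := bnd s us rs; rewrite sz ltnNge leqnSn.
suff -> : dist_lap_radius R e = m by [].
apply/eqP; rewrite eq_le; apply/andP; split.
  by apply: ge_sup; [exists m | move=> a /=; exact: mmax].
by apply: ub_le_sup => //; exists m => a /=; exact: mmax.
Qed.

End Largest.

(* Main.v *)
(* The distance Laplacian form of [G] at [x] is the sum over pairs of
   d(u,v) (x_u - x_v)^2, so it suffices to show that, for the principal
   eigenvector [x] of [G], the vertices can be placed on the kite so that its
   form is at least as large.  Sorting the vertices along a path gives the form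
   sum over pairs of (x_u - x_v)^2 plus sum over triples of
   (max x - min x)^2, which mentions no order; the kite on the sorted vertices
   loses from it the sum of (x_a - x_v)^2 over v <> a, b, where a, b are the two
   lowest (or, at the other end, the two highest) vertices.  That every connected
   graph with a cycle loses at least one of these two amounts, for every [x], is
   proved by growing the graph from its cycle by pendant vertices.  A new vertex
   [z] whose value is not extreme is simply deleted.  If [z] is extreme and
   attached to [u], the induction hypothesis is applied to the smaller graph with
   the value of [z] put at [u] instead.  What is gained in each step comes from
   the two vertices that a cycle forces at the same distance from any centre.

   In the case of equality the sorted eigenvector of [G] is an eigenvector of the
   kite for the same eigenvalue; comparing the two eigenvalue equations at the
   tip of the kite forces two vertices of [G] at distance [n - 2] from the
   corresponding vertex, and then [G] is a kite. *)
Require Import Defs.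
From mathcomp Require Import all_boot all_order all_algebra.
From mathcomp Require Import all_classical reals.
From mathcomp Require Import topology normedtype derive.
From mathcomp Require Import finset zify ring lra.

Set Implicit Arguments.
Unset Strict Implicit.
Unset Printing Implicit Defensive.
Import Order.TTheory GRing.Theory Num.Theory.
Local Open Scope ring_scope.

(** * Path form and kite loss *)

Section SquareForms.
Variables (R : realFieldType) (T : finType).
Implicit Types (x y : T -> R) (u v w z : T) (V W : {set T}).

Definition sqd x u v : R := (x u - x v) ^+ 2.
Definition sqdiam x u v w : R :=
  Num.max (sqd x u v) (Num.max (sqd x u w) (sqd x v w)).

Lemma sqdC x u v : sqd x u v = sqd x v u.
Proof. by rewrite /sqd -sqrrN opprB. Qed.

Lemma sqdxx x u : sqd x u u = 0.
Proof. by rewrite /sqd subrr expr0n. Qed.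

Lemma sqd_ge0 x u v : 0 <= sqd x u v.
Proof. exact: sqr_ge0. Qed.

Lemma sqdN x u v : sqd (\- x) u v = sqd x u v.
Proof. by rewrite /sqd /= -opprD sqrrN. Qed.

Lemma sqdiamN x u v w : sqdiam (\- x) u v w = sqdiam x u v w.
Proof. by rewrite /sqdiam !sqdN. Qed.

Lemma sqdiamC x u v w : sqdiam x u v w = sqdiam x u w v.
Proof. by rewrite /sqdiam (sqdC x w v) maxCA. Qed.

Lemma sqdiamCA x u v w : sqdiam x u v w = sqdiam x v u w.
Proof. by rewrite /sqdiam (sqdC x v u) [X in Num.max _ X]maxC. Qed.

Lemma sqdiamxx x u v : sqdiam x u u v = sqd x u v.
Proof. by rewrite /sqdiam sqdxx maxxx; apply/max_idPr; exact: sqd_ge0. Qed.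

Lemma sqdiam_diag x u v : sqdiam x u v v = sqd x u v.
Proof. by rewrite sqdiamCA sqdiamC sqdiamxx sqdC. Qed.

Lemma sqdiam_ge x u v w :
  [/\ sqd x u v <= sqdiam x u v w, sqd x u w <= sqdiam x u v w
    & sqd x v w <= sqdiam x u v w].
Proof. by rewrite /sqdiam !le_max !lexx !orbT. Qed.

Lemma sum2_setU1 (F : T -> T -> R) z V : z \notin V ->
    (forall u v, F u v = F v u) ->
  \sum_(u in z |: V) \sum_(v in z |: V) F u v =
  F z z + 2 * (\sum_(v in V) F z v) + \sum_(u in V) \sum_(v in V) F u v.
Proof.
move=> zV FC; rewrite big_setU1 //= big_setU1 //=.
under [X in _ + X]eq_bigr => u _ do rewrite big_setU1 //= FC.
by rewrite big_split /=; lra.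
Qed.

(* When the vertices of [V] are laid out on a path in the order of their values,
   [(1/6) * triple_form x V] is the distance Laplacian form of the path: a pair
   at distance [k + 1] is counted once for each of the [k] vertices in between
   and once more by the triples with a repeated vertex. *)
Definition triple_form x V : R :=
  \sum_(u in V) \sum_(v in V) \sum_(w in V) sqdiam x u v w.

Lemma triple_form_setU1 x z V : z \notin V ->
  triple_form x (z |: V) = triple_form x V +
    3 * (\sum_(v in V) \sum_(w in V) sqdiam x z v w + \sum_(v in V) sqd x z v).
Proof.
move=> zV; rewrite /triple_form sum2_setU1 //; last first.
  by move=> u v; apply: eq_bigr => w _; rewrite sqdiamCA.
rewrite big_setU1 //= sqdiamxx sqdxx add0r.
under eq_bigr do rewrite sqdiamxx.
under [X in 2 * X]eq_bigr => v _ do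
  rewrite big_setU1 //= sqdiamC sqdiamxx.
under [X in _ + X]eq_bigr => u _.
  under eq_bigr => v _ do rewrite big_setU1 //= -sqdiamCA sqdiamC -sqdiamCA.
  rewrite big_split /=.
  over.
rewrite big_split big_split /=.
set A := \sum_(i in V) \sum_(w in V) _; set B := \sum_(i in V) sqd x z i.
set A' := \sum_(i in V) \sum_(j in V) sqdiam x z j i.
have -> : A' = A by apply: eq_bigr => u _; apply: eq_bigr => v _; rewrite sqdiamC.
by rewrite /triple_form; lra.
Qed.

Lemma sqdiam_ge_max x u v w :
  Num.max (sqd x u v) (sqd x u w) <= sqdiam x u v w.
Proof. by have [h1 h2 _] := sqdiam_ge x u v w; rewrite ge_max h1 h2. Qed.

Lemma sum2_ge_pair (F : T -> T -> R) V a b :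
    (forall u v, 0 <= F u v) -> a \in V -> b \in V -> a != b ->
  F a b + F b a <= \sum_(u in V) \sum_(v in V) F u v.
Proof.
move=> F0 aV bV ab; have ba : b != a by rewrite eq_sym.
have term u v : v \in V -> F u v <= \sum_(w in V) F u w.
  by move=> vV; rewrite (bigD1 v) //= lerDl sumr_ge0.
rewrite (bigD1 a) //= [X in _ <= _ + X](bigD1 b) ?bV //= addrA.
apply: ler_wpDr; first by do 2![apply: sumr_ge0 => ? _].
by apply: lerD; exact: term.
Qed.

(** The excess of [sqdiam] over the larger squared distance to [z] is nonnegative on every pair, so
    the ordered pairs [(a, b)] and [(b, a)] may be kept and the others dropped. The vertex [t] is
    whichever of [a], [b] has the value farther from that of [z]. *)
Lemma sum_sqdiam_gain x z V a b : a \in V -> b \in V ->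
  exists2 t, t \in V &
    \sum_(v in V) \sum_(w in V) Num.max (sqd x z v) (sqd x z w)
      + 2 * sqdiam x z a b <=
    \sum_(v in V) \sum_(w in V) sqdiam x z v w + 2 * sqd x z t.
Proof.
move=> aV bV; pose F v w := sqdiam x z v w - Num.max (sqd x z v) (sqd x z w).
have F0 v w : 0 <= F v w by rewrite subr_ge0 sqdiam_ge_max.
have sumF : \sum_(v in V) \sum_(w in V) F v w =
    \sum_(v in V) \sum_(w in V) sqdiam x z v w -
    \sum_(v in V) \sum_(w in V) Num.max (sqd x z v) (sqd x z w).
  by rewrite -sumrB; apply: eq_bigr => v _; rewrite -sumrB.
have [ab|ab] := eqVneq a b.
  exists a => //; rewrite {}ab sqdiam_diag.
  have : 0 <= \sum_(v in V) \sum_(w in V) F v w.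
    by do 2![apply: sumr_ge0 => ? _].
  by rewrite sumF; lra.
have [t tV tE] : exists2 t, t \in V & Num.max (sqd x z a) (sqd x z b) = sqd x z t.
  by case: (leP (sqd x z a) (sqd x z b)) => h; [exists b | exists a].
exists t => //; have := sum2_ge_pair F0 aV bV ab.
by rewrite sumF /F (sqdiamC x z b a) (maxC (sqd x z b)) tE; lra.
Qed.

End SquareForms.

(** * Star bounds and the effect of a pendant vertex on the forms *)

Section Layers.
Variables (R : realFieldType) (T : finType) (d : T -> T -> nat).
Hypotheses (dC : forall u v, d u v = d v u) (dxx : forall u, d u u = 0%N).
Implicit Types (x y : T -> R) (u v w z : T) (V W : {set T}).

Definition leaf_at u z V := forall v, v \in V -> (d z v <= (d u v).+1)%N.

(* With [b = false] this holds as soon as every vertex at distance [k] from [u]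
   has vertices at all smaller distances: then [d u v] is at most one plus the
   number of vertices nearer to [u].  The extra term for [b = true] is available
   when two vertices are at the same distance from [u]. *)
Definition star_bound (b : bool) V u := forall y t,
    (forall v, 0 <= y v) -> y u = 0 -> t \in V ->
  2 * \sum_(v in V) (d u v)%:R * y v + \sum_(v in V) y v + 2 * b%:R * y t <=
  \sum_(v in V) \sum_(w in V) Num.max (y v) (y w).

(** The bound at [u] is applied to [y] with its value at [u] reset to 0. Passing from [u] to [z]
    lengthens each distance by at most one; the pairs containing [z] or [u] pay for this. *)
Lemma star_bound_center (b : bool) V u z : z \notin V -> u \in V ->
    leaf_at u z V -> (b ==> (1 < #|V|)%N) ->
  star_bound b V u -> star_bound b (z |: V) z.
Proof.
move=> zV uV zu bV st y t y0 yz tzV.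
have maxzE : forall v, Num.max (y z) (y v) = y v by move=> v; rewrite yz; apply/max_idPr.
rewrite sum2_setU1 //; last by move=> u' v; rewrite maxC.
have -> : \sum_(v in V) Num.max (y z) (y v) = \sum_(v in V) y v by apply: eq_bigr.
rewrite maxxx yz add0r.
rewrite !big_setU1 //= dxx mul0r add0r yz add0r.
pose W := V :\ u; have uW : u \notin W by rewrite !inE eqxx.
have VE : V = u |: W by rewrite setD1K.
pose y' v := if v == u then 0 else y v.
have y'0 v : 0 <= y' v by rewrite /y'; case: eqP.
have y'u : y' u = 0 by rewrite /y' eqxx.
have y'E v : v \in W -> y' v = y v by rewrite /y' !inE => /andP[/negbTE->].
have st' t' : t' \in V ->
    2 * (\sum_(v in W) (d u v)%:R * y v) + 2 * b%:R * y' t' <=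
    \sum_(v in W) \sum_(w in W) Num.max (y v) (y w) + \sum_(v in W) y v.
  move=> t'V; have := st y' t' y'0 y'u t'V.
  rewrite {1 2 3 4}VE sum2_setU1 //; last by move=> u' v; rewrite maxC.
  rewrite !big_setU1 //= dxx mul0r add0r y'u maxxx !add0r.
  under eq_bigr => v vW do rewrite y'E //.
  under [X in _ + X + _ <= _]eq_bigr => v vW do rewrite y'E //.
  under [X in _ <= 2 * X + _]eq_bigr => v vW do rewrite y'E // (max_idPr (y0 v)).
  under [X in _ <= _ + X]eq_bigr => v vW.
    under eq_bigr => w wW do rewrite !y'E //.
    over.
  by move=> H; lra.
have dle : \sum_(v in W) (d z v)%:R * y v <=
    \sum_(v in W) (d u v)%:R * y v + \sum_(v in W) y v.
  rewrite -big_split /=; apply: ler_sum => v vW; rewrite -[X in _ + X]mul1r -mulrDl natr1.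
  rewrite ler_wpM2r // ler_nat; apply: zu; by move: vW; rewrite !inE => /andP[].
have duz : (d z u)%:R * y u <= y u.
  by rewrite -[leRHS]mul1r ler_wpM2r // lern1 (leq_trans (zu _ uV)) // dxx.
rewrite VE sum2_setU1 //; last by move=> u' v; rewrite maxC.
rewrite !big_setU1 //= maxxx.
set S := \sum_(v in W) Num.max (y u) (y v).
have SW : \sum_(v in W) y v <= S by apply: ler_sum => v _; rewrite le_max lexx orbT.
(* If [t] is [u], its value is erased in [y']; any other vertex [t'] of [V] then takes its place,
   and the pair of [u] and [t'] supplies [y u]. *)
have [t' t'V t'E] : exists2 t', t' \in V &
    \sum_(v in W) y v + b%:R * y t <= S + b%:R * y' t'.
  have [->|tz] := eqVneq t z; first by exists u => //; rewrite yz y'u !mulr0 !addr0.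
  have tV : t \in V by move: tzV; rewrite in_setU1 (negbTE tz).
  have [tu|tu] := eqVneq t u; last by exists t; rewrite // /y' (negbTE tu) lerD2r.
  case: b bV {st st'} => [/= V1|_]; last by exists u; rewrite // !mul0r !addr0.
  have /card_gt0P[t' t'W] : (0 < #|W|)%N.
    by move: V1; rewrite VE cardsU1 uW.
  exists t'; first by rewrite VE in_setU1 t'W orbT.
  rewrite y'E // /S tu !(bigD1 t' (P := [in W])) //= !mul1r.
  have h1 : y u <= Num.max (y u) (y t') by rewrite le_max lexx.
  have h2 : \sum_(v in W | v != t') y v <=
            \sum_(v in W | v != t') Num.max (y u) (y v).
    by apply: ler_sum => v _; rewrite le_max lexx orbT.
  lra.
have := st' t' t'V; lra.
Qed.

(** Every maximum over a pair with [z] is at least [y z], which gives [#|V|] copies of [y z] in each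
    order, while [d v z] is at most [#|V| - 1]. The spare copy serves the case [t = z]. *)
Lemma star_bound_leaf V u z v : z \notin V -> u \in V -> v \in V ->
    leaf_at u z V -> ((d u v).+2 <= #|V|)%N ->
  star_bound true V v -> star_bound true (z |: V) v.
Proof.
move=> zV uV vV zu duv st y t y0 yv tzV.
rewrite sum2_setU1 //; last by move=> u' w; rewrite maxC.
rewrite !big_setU1 //= maxxx.
have dvz : (d v z)%:R * y z <= ((d u v).+1)%:R * y z.
  by rewrite ler_wpM2r // ler_nat dC zu.
have mxS : #|V|%:R * y z <= \sum_(w in V) Num.max (y z) (y w).
  rewrite mulr_natl -sumr_const; apply: ler_sum => w _.
  by rewrite le_max lexx.
have cS : ((d u v).+1)%:R * y z + y z <= #|V|%:R * y z.
  by rewrite -[X in _ + X]mul1r -mulrDl natr1 ler_wpM2r // ler_nat.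
have [tz|tz] := eqVneq t z.
  have := st y v y0 yv vV; rewrite yv tz !mulr1; lra.
have tV : t \in V by move: tzV; rewrite in_setU1 (negbTE tz).
have := st y t y0 yv tV; have := y0 z; rewrite !mulr1; lra.
Qed.

(* Ordered pairs: twice the distance Laplacian form. *)
Definition dist_form x V : R :=
  \sum_(u in V) \sum_(v in V) (d u v)%:R * sqd x u v.

Lemma dist_form_setU1 x z V : z \notin V ->
  dist_form x (z |: V) = dist_form x V + 2 * \sum_(v in V) (d z v)%:R * sqd x z v.
Proof.
move=> zV; rewrite /dist_form sum2_setU1 //; last by move=> u v; rewrite dC sqdC.
by rewrite sqdxx mulr0 add0r addrC.
Qed.

Lemma dist_formN x V : dist_form (\- x) V = dist_form x V.
Proof. by do 2![apply: eq_bigr => ? _]; rewrite sqdN. Qed.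

Lemma triple_formN x V : triple_form (\- x) V = triple_form x V.
Proof. by do 3![apply: eq_bigr => ? _]; rewrite sqdiamN. Qed.

Lemma star_sqd (b : bool) V u x t : star_bound b V u -> t \in V ->
  2 * \sum_(v in V) (d u v)%:R * sqd x u v + \sum_(v in V) sqd x u v
    + 2 * b%:R * sqd x u t <=
  \sum_(v in V) \sum_(w in V) Num.max (sqd x u v) (sqd x u w).
Proof. by move=> st; apply: st => [v|]; rewrite ?sqd_ge0 ?sqdxx. Qed.

Lemma star_center_sqd (b : bool) V z x t : z \notin V ->
    star_bound b (z |: V) z -> t \in V ->
  2 * \sum_(v in V) (d z v)%:R * sqd x z v + 2 * b%:R * sqd x z t <=
  \sum_(v in V) \sum_(w in V) Num.max (sqd x z v) (sqd x z w)
    + \sum_(v in V) sqd x z v.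
Proof.
move=> zV st tV; have tzV : t \in z |: V by rewrite in_setU1 tV orbT.
have := star_sqd x st tzV.
rewrite sum2_setU1 //; last by move=> u' w; rewrite maxC.
rewrite !big_setU1 //= maxxx sqdxx mulr0 !add0r.
under [X in _ <= 2 * X + _]eq_bigr => v _ do rewrite (max_idPr (sqd_ge0 _ _ _)).
lra.
Qed.

Lemma tree_form_center x V z : z \notin V -> star_bound false (z |: V) z ->
    3 * dist_form x V <= triple_form x V ->
  3 * dist_form x (z |: V) <= triple_form x (z |: V).
Proof.
move=> zV st H; have [V0|[t tV]] := set_0Vmem V.
  have e1 (F : T -> R) : \sum_(v in V) F v = 0 by rewrite V0 big_set0.
  by rewrite dist_form_setU1 // triple_form_setU1 // !e1; lra.
rewrite dist_form_setU1 // triple_form_setU1 //.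
have := star_center_sqd x zV st tV.
have : \sum_(v in V) \sum_(w in V) Num.max (sqd x z v) (sqd x z w) <=
       \sum_(v in V) \sum_(w in V) sqdiam x z v w.
  by do 2![apply: ler_sum => ? _]; exact: sqdiam_ge_max.
rewrite mulr0 mul0r; lra.
Qed.

(** The extra term of the star bound is spent at the vertex [t] given by [sum_sqdiam_gain], so that
    all of [sqdiam x z a b] remains as slack. *)
Lemma form_center_gain x V z a b : z \notin V -> a \in V -> b \in V ->
    star_bound true (z |: V) z ->
  3 * dist_form x (z |: V) + 6 * sqdiam x z a b + triple_form x V <=
  triple_form x (z |: V) + 3 * dist_form x V.
Proof.
move=> zV aV bV st; have [t tV gain] := sum_sqdiam_gain x z aV bV.
rewrite dist_form_setU1 // triple_form_setU1 //.
have := star_center_sqd x zV st tV; rewrite mulr1; lra.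
Qed.

(* For a pendant vertex [z] attached to [u], deleting [u] and putting [z] in its
   place amounts to deleting [z] and changing the value at [u] to [x z]. *)
Definition relabel x u z v := if v == u then x z else x v.

(** After relabelling, [u] carries the value of [z], and [z] is at most one step farther than [u]
    from every vertex. The triples [z], [u], [v] pay for that step, with the last sum left over; the
    term [sqdiam x u a b] is the gain of [u] as a centre over [W]. *)
Lemma form_relabel_gain x W u z a b : u \notin W -> z \notin u |: W ->
    a \in W -> b \in W -> leaf_at u z (u |: W) -> star_bound true (u |: W) u ->
  3 * dist_form x (z |: (u |: W)) + triple_form (relabel x u z) (u |: W)
    + 6 * sqdiam x u a b + 6 * \sum_(v in W) (sqdiam x z u v - sqd x z v) <=
  triple_form x (z |: (u |: W)) + 3 * dist_form (relabel x u z) (u |: W).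
Proof.
move=> uW zV aW bW zu st; have [t tW gain] := sum_sqdiam_gain x u aW bW.
have rE v : v \in W -> relabel x u z v = x v.
  by rewrite /relabel; case: eqP => // -> uW'; rewrite uW' in uW.
have ru : relabel x u z u = x z by rewrite /relabel eqxx.
have dW : dist_form (relabel x u z) W = dist_form x W.
  by apply: eq_bigr => v vW; apply: eq_bigr => w wW; rewrite /sqd !rE.
have tW' : triple_form (relabel x u z) W = triple_form x W.
  by do 3![apply: eq_bigr => ? ?]; rewrite /sqdiam /sqd !rE.
have sE v : v \in W -> sqd (relabel x u z) u v = sqd x z v by move=> vW; rewrite /sqd ru rE.
rewrite (dist_form_setU1 _ zV) (triple_form_setU1 _ zV).
rewrite !(dist_form_setU1 _ uW) !(triple_form_setU1 _ uW) dW tW'.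
rewrite (sum2_setU1 uW) ?(big_setU1 _ uW) /=; last by move=> *; rewrite sqdiamC.
rewrite sqdiam_diag.
have -> : \sum_(v in W) \sum_(w in W) sqdiam (relabel x u z) u v w =
          \sum_(v in W) \sum_(w in W) sqdiam x z v w.
  by do 2![apply: eq_bigr => ? ?]; rewrite /sqdiam /sqd ru !rE.
rewrite (eq_bigr _ sE).
under [X in _ <= _ + 3 * (_ + 2 * X)]eq_bigr => v vW do rewrite sE //.
have dle : \sum_(v in W) (d z v)%:R * sqd x z v <=
    \sum_(v in W) (d u v)%:R * sqd x z v + \sum_(v in W) sqd x z v.
  rewrite -big_split /=; apply: ler_sum => v vW; rewrite -[X in _ + X]mul1r -mulrDl natr1.
  by rewrite ler_wpM2r ?sqd_ge0 // ler_nat zu // in_setU1 vW orbT.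
have dzu : (d z u)%:R * sqd x z u <= sqd x z u.
  by rewrite -[leRHS]mul1r ler_wpM2r ?sqd_ge0 // lern1 (leq_trans (zu _ (setU11 _ _))) // dxx.
rewrite sumrB; have := star_center_sqd x uW st tW; rewrite mulr1; lra.
Qed.

Definition lowest x V a b :=
  [/\ a \in V, b \in V, a != b, x a <= x b &
     forall v, v \in V -> v != a -> x b <= x v].

(* If [a] and [b] are the two lowest vertices, this is what the path form on the
   sorted vertices loses when [a] and [b] become the twins of a kite. *)
Definition kite_loss x V a b : R := \sum_(v in V) sqd x a v - sqd x a b.

(** Negating [x] lets the loss be taken at the top end. The factor is 6 because the ordered pairs of
    [dist_form] count the loss twice. *)
Definition kite_bound V := forall x, exists a b,
  (lowest x V a b \/ lowest (\- x) V a b) /\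
  3 * dist_form x V + 6 * kite_loss x V a b <= triple_form x V.

Lemma lowest_ex x V : (1 < #|V|)%N -> exists a b, lowest x V a b.
Proof.
move=> V1; have [a0 a0V] : exists a, a \in V by apply/card_gt0P; apply: ltnW.
have [a aV amin] : exists2 a, a \in V & forall v, v \in V -> x a <= x v.
  by case: (arg_minP x a0V) => a; exists a.
have [b0] : exists b, b \in V :\ a.
  by apply/card_gt0P; move: V1; rewrite (cardsD1 a) aV.
case/(arg_minP x) => b /setD1P[ba bV] bmin.
exists a, b; split; rewrite // 1?eq_sym ?amin // => v vV va.
by apply: bmin; apply/setD1P.
Qed.

Lemma kite_lossN x V a b : kite_loss (\- x) V a b = kite_loss x V a b.
Proof. by rewrite /kite_loss sqdN; under eq_bigr do rewrite sqdN. Qed.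

Lemma lowest_min x V a b : lowest x V a b -> forall v, v \in V -> x a <= x v.
Proof.
case=> aV bV ab xab H v vV; have [->//|va] := eqVneq v a.
exact: le_trans (H v vV va).
Qed.

(** Ties can leave several lowest pairs, but the two lowest values are the same for all of them, and
    the loss depends on the pair only through these values. *)
Lemma kite_loss_lowest x V a b a' b' : lowest x V a b -> lowest x V a' b' ->
  kite_loss x V a b = kite_loss x V a' b'.
Proof.
have snd_le a1 b1 a2 b2 : lowest x V a1 b1 -> lowest x V a2 b2 -> x b1 <= x b2.
  move=> l1 l2; have [a1V b1V ab1 xab1 H1] := l1; have [a2V b2V ab2 xab2 H2] := l2.
  have [E|b2a1] := eqVneq b2 a1; last exact: H1.
  by apply: le_trans xab2; apply: H1; rewrite -?E.
move=> l1 l2.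
have xaa : x a = x a'.
  apply/eqP; rewrite eq_le (lowest_min l1) ?(lowest_min l2) //.
    by case: l1. by case: l2.
have xbb : x b = x b' by apply/eqP; rewrite eq_le !(snd_le _ _ _ _ l1 l2, snd_le _ _ _ _ l2 l1).
by rewrite /kite_loss /sqd xaa xbb.
Qed.

Lemma sqd_le x a b c f : x a <= x b -> x b - x a <= x f - x c ->
  sqd x a b <= sqd x c f.
Proof.
move=> ab le; rewrite (sqdC x a) (sqdC x c) /sqd ler_sqr ?nnegrE ?subr_ge0 //.
by rewrite -subr_ge0 (le_trans _ le) // subr_ge0.
Qed.

(** If [z] is not below [b], the pair stays and the loss grows by [sqd x a z]; otherwise [z]
    replaces [b] and the loss grows by [sqd x a b]. Either amount is covered by the slack of
    [form_center_gain]. *)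
Lemma center_loss x V z a b : z \notin V -> lowest x V a b -> x a <= x z ->
  exists a1 b1 c f, [/\ lowest x (z |: V) a1 b1, c \in V, f \in V &
    kite_loss x (z |: V) a1 b1 <= kite_loss x V a b + sqdiam x z c f].
Proof.
move=> zV l xaz; have [aV bV ab xab H] := l.
have az : a != z by apply: contraNneq zV => <-.
have [bz|zb] := leP (x b) (x z).
  exists a, b, a, a; split=> //.
    split; rewrite ?in_setU1 ?aV ?bV ?orbT // => v.
    by case/setU1P => [->|/H].
  rewrite /kite_loss big_setU1 //= sqdiam_diag (sqdC x z a); lra.
exists a, z, a, b; split=> //.
  split; rewrite ?in_setU1 ?aV ?eqxx ?orbT // => v.
  case/setU1P => [->//|vV va]; exact: le_trans (ltW zb) (H v vV va).
have [_ _ h] := sqdiam_ge x z a b.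
by rewrite /kite_loss big_setU1 //=; lra.
Qed.

(** * Kite loss after relabelling, for a lowest pendant vertex *)

Section Relabel.
Variables (x : T -> R) (W : {set T}) (u z : T).
Hypotheses (uW : u \notin W) (zuW : z \notin u |: W).
Hypothesis zmin : forall v, v \in u |: W -> x z <= x v.

Let x' := relabel x u z.
Let gain := \sum_(v in W) (sqdiam x z u v - sqd x z v).
Let V1 := z |: (u |: W).

Let ru : x' u = x z. Proof. by rewrite /x' /relabel eqxx. Qed.

Let rE v : v \in W -> x' v = x v.
Proof. by rewrite /x' /relabel; case: eqP => // -> uW'; case/negP: uW. Qed.

Lemma relabel_loss_in a b : a \in W -> b \in W ->
  kite_loss x' (u |: W) a b = \sum_(v in W) sqd x a v + sqd x a z - sqd x a b.
Proof.
move=> aW bW; rewrite /kite_loss big_setU1 //= /sqd ru !rE // addrC.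
under eq_bigr => v vW do rewrite rE //.
lra.
Qed.

Lemma relabel_loss_low p : p \in W ->
  kite_loss x' (u |: W) u p = \sum_(v in W) sqd x z v - sqd x z p.
Proof.
move=> pW; rewrite /kite_loss big_setU1 //= sqdxx add0r /sqd ru !rE //.
by under eq_bigr => v vW do rewrite rE //.
Qed.

Let gain_ge0 v : 0 <= sqdiam x z u v - sqd x z v.
Proof. by rewrite subr_ge0; have [_ h _] := sqdiam_ge x z u v. Qed.

Let uz : u != z.
Proof. by apply: contraNneq zuW => <-; rewrite setU11. Qed.

Let inW v : v \in W -> [/\ v \in u |: W, v \in V1, v != u, v != z & x z <= x v].
Proof.
move=> vW; have vuW : v \in u |: W by rewrite in_setU1 vW orbT.
have vu : v != u by apply: contraNneq uW => <-.
have vz : v != z by apply: contraNneq zuW => <-.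
by split; rewrite ?zmin // setU1r.
Qed.

Let inU : u \in V1. Proof. by rewrite !in_setU1 eqxx orbT. Qed.

Let loss_V1 a b : kite_loss x V1 a b =
  \sum_(v in W) sqd x a v + sqd x a u + sqd x a z - sqd x a b.
Proof. by rewrite /kite_loss /V1 !big_setU1 //=; lra. Qed.

(** The cases are the positions of [u] relative to the two highest vertices of [W]. Unless [u] is
    above both, the loss grows by a single squared difference. If it is, the loss is measured from
    [u] instead of [a], and [gain] pays for the change. *)
Lemma relabel_top_loss a b : lowest (\- x) W a b ->
  exists a1 b1 c f, [/\ lowest (\- x) V1 a1 b1, c \in W, f \in W &
    kite_loss x V1 a1 b1 <= kite_loss x' (u |: W) a b + sqdiam x u c f + gain].
Proof.
case=> aW bW ab /=; rewrite lerN2 => xba H.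
have Hb v : v \in W -> v != a -> x v <= x b by move=> vW /(H v vW); rewrite lerN2.
have xzu : x z <= x u by apply: zmin; rewrite setU11.
have g0 : 0 <= gain by apply: sumr_ge0.
have [auW aV1 au az xza] := inW aW; have [buW bV1 bu bz xzb] := inW bW.
rewrite relabel_loss_in //.
have [ub|bu'] := leP (x u) (x b).
  exists a, b, a, a; split=> //.
    split; rewrite //= ?lerN2 // => v.
    by rewrite lerN2; case/setU1P => [->//|/setU1P[->//|/Hb]]; apply.
  by rewrite loss_V1 sqdiam_diag (sqdC x u a); lra.
have [ua|au'] := leP (x u) (x a).
  exists a, u, a, b; split=> //.
    split; rewrite //= ?lerN2 // => v.
    rewrite lerN2; case/setU1P => [->//|/setU1P[->//|vW /(Hb _ vW)]].
    by move/le_trans; apply; exact: ltW.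
  by have [_ _ h] := sqdiam_ge x u a b; rewrite loss_V1; lra.
exists u, a, b, b; split=> //.
  split; rewrite //= ?lerN2 1?eq_sym ?(ltW au') // => v.
  rewrite lerN2; case/setU1P => [->//|/setU1P[->|vW _]]; first by rewrite eqxx.
  have [->//|va] := eqVneq v a; exact: le_trans (Hb v vW va) xba.
rewrite loss_V1 sqdiam_diag /gain (bigD1 a) //=.
rewrite (bigD1 a (P := fun v => v \in W) (F := fun v => sqdiam x z u v - _)) //=.
rewrite (bigD1 b (P := fun v => (v \in W) && (v != a))) ?bW 1?eq_sym //=.
rewrite (bigD1 b (P := fun v => (v \in W) && (v != a))
  (F := fun v => sqdiam x z u v - _)) ?bW 1?eq_sym //=.
rewrite (bigD1 b (P := fun v => (v \in W))) //=.
(* When the value at [v] lies between those at [z] and [u], [sqd x z u - sqd x z v] is at least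
   [sqd x u v]. *)
have h : \sum_(v | (v \in W) && (v != a) && (v != b)) sqd x u v <=
  \sum_(v | (v \in W) && (v != a) && (v != b)) (sqdiam x z u v - sqd x z v).
  apply: ler_sum => v /andP[/andP[vW va] _].
  have [h _ _] := sqdiam_ge x z u v.
  have [_ _ _ _ zv] := inW vW; have vb := Hb v vW va.
  move: h; rewrite /sqd; nra.
have h1 : 0 <= \sum_(i in W | i != b) sqd x a i by apply: sumr_ge0 => *; exact: sqd_ge0.
have [h2 _ _] := sqdiam_ge x z u a; have h3 := gain_ge0 b.
by rewrite sqdxx (sqdC x u z) (sqdC x a z); lra.
Qed.

(** The loss grows by [sqd x z u] if [u] is not below [p], and by [sqd x z p] otherwise. The
    hypothesis on the gaps bounds [sqd x z p] by [sqd x p a]; in the first case the term of [gain]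
    at [p] covers the remainder. *)
Lemma relabel_bottom_loss a p : a \in W -> p \in W ->
    (forall v, v \in W -> x p <= x v) ->
    x p - x z <= x a - x p ->
  exists a1 b1 c f, [/\ lowest x V1 a1 b1, c \in W, f \in W &
    kite_loss x V1 a1 b1 <= kite_loss x' (u |: W) u p + sqdiam x u c f + gain].
Proof.
move=> aW pW pmin cond; have [puW pV1 pu pz xzp] := inW pW.
have xzu : x z <= x u by apply: zmin; rewrite setU11.
have zV1 : z \in V1 by rewrite setU11.
have [_ _ diam_pa] := sqdiam_ge x u p a.
rewrite relabel_loss_low //; have [xpu|xup] := leP (x p) (x u).
  exists z, p, p, a; split=> //.
    split; rewrite 1?eq_sym // => v.
    by case/setU1P => [->|/setU1P[->//|vW _]]; [rewrite eqxx | exact: pmin].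
  have diam_ge : sqd x z p <= sqdiam x u p a.
    by apply: le_trans diam_pa; apply: sqd_le.
  have gain_p : sqdiam x z u p - sqd x z p <= gain.
    by rewrite /gain (bigD1 p) //= lerDl sumr_ge0.
  have [h _ _] := sqdiam_ge x z u p.
  by rewrite loss_V1 sqdxx; lra.
exists z, u, p, a; split=> //.
  split; rewrite 1?eq_sym // => v.
  case/setU1P => [->|/setU1P[->//|vW _]]; first by rewrite eqxx.
  exact: le_trans (ltW xup) (pmin v vW).
have diam_ge : sqd x z p <= sqdiam x u p a by apply: le_trans diam_pa; apply: sqd_le.
have g0 : 0 <= gain by apply: sumr_ge0.
by rewrite loss_V1 sqdxx; lra.
Qed.

(* If even the top of [W] is closer to the bottom of [W] than [z] is, then losing
   at the top end is cheaper than losing at [z]. *)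
Lemma relabel_loss_compare a b p : lowest (\- x) W a b -> p \in W ->
    (forall v, v \in W -> x p <= x v) -> x a - x p <= x p - x z ->
  kite_loss x' (u |: W) a b <= kite_loss x' (u |: W) u p.
Proof.
move=> l pW pmin cond; have [aW bW ab /= xba _] := l.
rewrite relabel_loss_in // relabel_loss_low //.
have xzW v : v \in W -> x z <= x v by case/inW.
have amax v : v \in W -> x v <= x a by move=> /(lowest_min l) /=; rewrite lerN2.
have term v w : v \in W -> w \in W -> sqd x a v <= sqd x z w.
  move=> vW wW; have h1 := pmin v vW; have h2 := pmin w wW; have h3 := amax v vW.
  by rewrite sqdC; apply: sqd_le; lra.
have [pa|pa] := eqVneq p a.
  have xE v : v \in W -> x v = x a.
    by move=> vW; apply/eqP; rewrite eq_le amax // -pa pmin.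
  have -> : \sum_(v in W) sqd x a v = 0.
    by apply: big1 => v vW; rewrite /sqd xE // subrr expr0n.
  have zE v : v \in W -> sqd x z v = sqd x a z by move=> vW; rewrite sqdC /sqd xE.
  rewrite (bigD1 a) //= (bigD1 b) ?bW 1?eq_sym //= !zE //.
  have : 0 <= \sum_(i | (i \in W) && (i != a) && (i != b)) sqd x z i.
    by apply: sumr_ge0 => *; exact: sqd_ge0.
  have := sqd_ge0 x a b; lra.
have sumD (F : T -> R) q : q \in W -> q != a ->
    \sum_(v in W) F v = F a + F q + \sum_(v in W :\ a :\ q) F v.
  move=> qW qa; rewrite (big_setD1 a) //= (big_setD1 q) ?addrA //=.
  by rewrite !inE qa.
have cardD q : q \in W -> q != a -> #|W :\ a :\ q| = #|W|.-2.
  by move=> qW qa; rewrite (cardsD1 a W) aW (cardsD1 q (W :\ a)) !inE qa qW.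
rewrite (sumD _ b) 1?eq_sym // (sumD _ p) // sqdxx (sqdC x a z).
(* With two vertices removed on each side both sums have [#|W| - 2] terms, and [sqd x z p] separates
   them term by term. *)
have h1 : \sum_(v in W :\ a :\ b) sqd x a v <= sqd x z p *+ #|W|.-2.
  rewrite -(cardD b) 1?eq_sym // -sumr_const; apply: ler_sum => v.
  by rewrite !inE => /and3P[_ _ vW]; apply: term.
have h2 : sqd x z p *+ #|W|.-2 <= \sum_(v in W :\ a :\ p) sqd x z v.
  rewrite -(cardD p) // -sumr_const; apply: ler_sum => v.
  rewrite !inE => /and3P[_ _ vW]; have := pmin v vW; have := xzW p pW => h3 h4.
  by apply: sqd_le => //; lra.
lra.
Qed.

End Relabel.

Lemma lowestNN x V a b : lowest (\- \- x) V a b -> lowest x V a b.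
Proof.
case=> aV bV ab; rewrite /= !opprK => xab H.
by split=> // v vV /(H v vV); rewrite /= !opprK.
Qed.

(** The induction hypothesis for [x] itself serves unless [z] lies beyond the end where the loss is
    taken. In that case, up to sign, [z] is lowest, and the hypothesis is used for [relabel]. A loss
    at the bottom is kept if the gap above [z] is small compared with the spread of [W], and traded
    for a loss at the top otherwise. *)
Lemma kite_bound_leaf V u z : z \notin V -> u \in V -> (2 < #|V|)%N ->
    leaf_at u z V -> star_bound true V u -> kite_bound V ->
  kite_bound (z |: V).
Proof.
move=> zV uV V2 zu st IH x.
have stz : star_bound true (z |: V) z.
  by apply: star_bound_center st => //; rewrite implyTb ltnW.
pose good y := exists a b, (lowest y (z |: V) a b \/ lowest (\- y) (z |: V) a b) /\
  3 * dist_form y (z |: V) + 6 * kite_loss y (z |: V) a b <= triple_form y (z |: V).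
have goodN y : good (\- y) -> good y.
  case=> a [b []]; rewrite dist_formN triple_formN kite_lossN => l h.
  by exists a, b; split=> //; case: l => [|/lowestNN]; [right | left].
have mid y a b : lowest y V a b -> y a <= y z ->
    3 * dist_form y V + 6 * kite_loss y V a b <= triple_form y V -> good y.
  move=> l yaz h; have [a1 [b1 [c [f [l1 cV fV h1]]]]] := center_loss zV l yaz.
  exists a1, b1; split; first by left.
  have := form_center_gain y zV cV fV stz; lra.
have bot y : (forall v, v \in V -> y z <= y v) -> good y.
  move=> zmin; pose W := V :\ u; have VE : V = u |: W by rewrite setD1K.
  have uW : u \notin W by rewrite !inE eqxx.
  have W1 : (1 < #|W|)%N by move: V2; rewrite VE cardsU1 uW.
  have [a [b l]] := lowest_ex (\- y) W1; have [p [p' lp]] := lowest_ex y W1.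
  have pmin := lowest_min lp; have pW : p \in W by case: lp.
  have aW : a \in W by case: l.
  have bW : b \in W by case: l.
  move: zV zmin zu st (IH (relabel y u z)); rewrite /good {IH mid stz goodN}.
  rewrite {V2 uV}VE => zV zmin zu st [a0 [b0 [l0 h0]]].
  have top : 3 * dist_form (relabel y u z) (u |: W)
      + 6 * kite_loss (relabel y u z) (u |: W) a b
      <= triple_form (relabel y u z) (u |: W) ->
    exists a b, (lowest y (z |: (u |: W)) a b \/ lowest (\- y) (z |: (u |: W)) a b) /\
      3 * dist_form y (z |: (u |: W)) + 6 * kite_loss y (z |: (u |: W)) a b
      <= triple_form y (z |: (u |: W)).
    move=> h; have [a1 [b1 [c [f [l1 cW fW h1]]]]] := relabel_top_loss uW zV zmin l.
    exists a1, b1; split; first by right.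
    have := form_relabel_gain y uW zV cW fW zu st; lra.
  have rE v : v \in W -> relabel y u z v = y v.
    by rewrite /relabel; case: eqP => // -> uW'; rewrite uW' in uW.
  have ru : relabel y u z u = y z by rewrite /relabel eqxx.
  have zW v : v \in W -> y z <= y v by move=> vW; apply: zmin; rewrite in_setU1 vW orbT.
  have ltop : lowest (\- relabel y u z) (u |: W) a b.
    have [_ _ ab /= yab H] := l.
    split; rewrite /= ?in_setU1 ?aW ?bW ?orbT ?rE // => v.
    case/setU1P => [->|vW]; first by rewrite ru lerN2 zW.
    by rewrite rE //; apply: H.
  have lbot : lowest (relabel y u z) (u |: W) u p.
    split; rewrite ?setU11 ?in_setU1 ?pW ?orbT ?ru ?rE ?zW //.
      by apply: contraNneq uW => ->.
    by move=> v /setU1P[->|vW]; rewrite ?eqxx // rE // => _; apply: pmin.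
  case: l0 => l0; last first.
    apply: top; rewrite -kite_lossN (kite_loss_lowest ltop l0) kite_lossN.
    exact: h0.
  have h : 3 * dist_form (relabel y u z) (u |: W)
      + 6 * kite_loss (relabel y u z) (u |: W) u p
      <= triple_form (relabel y u z) (u |: W).
    by rewrite (kite_loss_lowest lbot l0).
  have [cond|cond] := leP (y p - y z) (y a - y p); last first.
    apply: top; have := relabel_loss_compare uW zV zmin l pW pmin (ltW cond); lra.
  have [a1 [b1 [c [f [l1 cW fW h1]]]]] :=
    relabel_bottom_loss uW zV zmin aW pW pmin cond.
  exists a1, b1; split; first by left.
  have := form_relabel_gain y uW zV cW fW zu st; lra.
have [a [b [l h]]] := IH x.
case: l => l; have [aV _ _ _ _] := l.
  have [az|za] := leP (x a) (x z); first exact: mid l az h.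
  apply: bot => v vV; apply: le_trans (ltW za) _; exact: lowest_min l _ vV.
apply: goodN; have [az|za] := leP ((\- x) a) ((\- x) z).
  by apply: mid l az _; rewrite dist_formN triple_formN kite_lossN.
apply: bot => v vV; apply: le_trans (ltW za) _; exact: lowest_min l _ vV.
Qed.

Variable e : rel T.
Hypotheses (eC : symmetric e) (de : forall u z v, e u z -> (d z v <= (d u v).+1)%N).

Lemma edge_leaf u z V : e u z -> leaf_at u z V.
Proof. by move=> uz v _; apply: de. Qed.

Lemma path_star z p : path e z p -> uniq (z :: p) ->
  star_bound false [set:: z :: p] z.
Proof.
elim: p z => [|u p IH] z; last first.
  move=> /= /andP[zu pu] /andP[zp up]; rewrite set_cons.
  apply: star_bound_center (IH u pu up); rewrite ?inE ?eqxx //.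
  by apply: edge_leaf; rewrite eC.
move=> _ _ y t y0 yz; rewrite set_cons set_nil finset.setU0.
by rewrite !big_set1 dxx yz maxxx !mulr0 mul0r !addr0.
Qed.

Lemma path_tree_form x z p : path e z p -> uniq (z :: p) ->
  3 * dist_form x [set:: z :: p] <= triple_form x [set:: z :: p].
Proof.
elim: p z => [|u p IH] z zp up.
  rewrite set_cons set_nil finset.setU0 /dist_form /triple_form !big_set1.
  by rewrite sqdiamxx sqdxx !mulr0.
have star := path_star zp up.
rewrite set_cons in star *; move: zp up => /= /andP[_ pu] /andP[zp up].
by apply: tree_form_center star (IH u pu up); rewrite inE.
Qed.

Lemma path_dist z p v : path e z p -> v \in p -> (d z v <= size p)%N.
Proof.
elim: p z => [//|u p IH] z /= /andP[zu pu].
have step : (d z v <= (d u v).+1)%N by apply: de; rewrite eC.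
by rewrite inE => /predU1P[E|/(IH _ pu) h]; apply: leq_trans step _; rewrite ?E ?dxx.
Qed.

(** * The cycle from which the graph grows *)

Section CycleBase.
Variables (w c : T) (p : seq T).
Hypotheses (p0 : (0 < size p)%N) (wpc : cycle e (w :: rcons p c))
  (uwpc : uniq (w :: rcons p c)).

Let ecw : e c w.
Proof. by move: wpc; rewrite /= rcons_path last_rcons => /andP[]. Qed.

Let pathwp : path e w p.
Proof. by move: wpc; rewrite /= !rcons_path => /andP[/andP[]]. Qed.

Let uniqwp : uniq (w :: p).
Proof.
move: uwpc; rewrite /= mem_rcons inE negb_or rcons_uniq.
by case/andP => /andP[_ ->] /andP[_ ->].
Qed.

Let cp : c \notin p.
Proof. by move: uwpc; rewrite /= rcons_uniq => /and3P[]. Qed.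

Let cw : c != w.
Proof. by move: uwpc; rewrite /= mem_rcons inE negb_or eq_sym => /andP[/andP[]]. Qed.

Let dwc : (d w c <= 1)%N.
Proof. by rewrite (leq_trans (de c ecw)) ?dxx. Qed.

Let set_rcons_c : [set:: rcons p c] = c |: [set:: p].
Proof. by apply/setP => v; rewrite !inE mem_rcons inE. Qed.

Lemma cycle_set : [set:: w :: rcons p c] = c |: [set:: w :: p].
Proof. by rewrite !set_cons set_rcons_c finset.setUCA. Qed.

(** Without [c] the cycle is a path starting at [w]. Since [c] is adjacent to [w], its distance
    costs one [y c], supplied by the pair with [w]; the pairs of [c] with [p] supply the extra
    [y t]. *)
Lemma cycle_star : star_bound true [set:: w :: rcons p c] w.
Proof.
have cwp : c \notin [set:: w :: p] by rewrite !inE negb_or cw.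
move=> y t y0 yw; rewrite cycle_set => tV.
rewrite sum2_setU1 //; last by move=> u' v; rewrite maxC.
rewrite !big_setU1 //= maxxx.
have wV : w \in [set:: w :: p] by rewrite !inE eqxx.
have := path_star pathwp uniqwp y0 yw wV.
have dyc : (d w c)%:R * y c <= y c by rewrite -[leRHS]mul1r ler_wpM2r // lern1.
have wp : w \notin [set:: p] by move: uniqwp; rewrite inE /= => /andP[].
have h : y c + y t <= \sum_(v in [set:: w :: p]) Num.max (y c) (y v).
  rewrite set_cons big_setU1 //= yw (max_idPl (y0 c)) lerD2l.
  have mx v : v \in p -> Num.max (y c) (y v) <= \sum_(v in [set:: p]) Num.max (y c) (y v).
    move=> vp; rewrite (big_setD1 v) ?inE //= lerDl sumr_ge0 // => *.
    by rewrite le_max y0.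
  move: tV; rewrite !inE => /or3P[/eqP->|/eqP->|tp].
  - case: p p0 mx => // q r _ /(_ q); rewrite inE eqxx => /(_ isT).
    by apply: le_trans; rewrite le_max lexx.
  - by rewrite yw sumr_ge0 // => *; rewrite le_max y0.
  - by apply: le_trans (mx t tp); rewrite le_max lexx orbT.
rewrite mulr0 mul0r mulr1; lra.
Qed.

Lemma cycle_card : #|[set:: w :: rcons p c]| = (size p).+2.
Proof. by rewrite cardsE (card_uniqP uwpc) /= size_rcons. Qed.

Lemma cycle_dist v : v \in [set:: w :: rcons p c] ->
  ((d w v).+2 <= #|[set:: w :: rcons p c]|)%N.
Proof.
rewrite cycle_card cycle_set !inE !ltnS => /or3P[/eqP->|/eqP->|vp].
- exact: leq_trans dwc p0.
- by rewrite dxx.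
- exact: path_dist pathwp vp.
Qed.

(** Removing the lowest vertex [w] leaves a path, for which [path_tree_form] holds. The distances
    from [w] are bounded along [p], and by one at [c]; this shortcut leaves the pairs of [c] with
    [p] free to pay the loss at [w]. *)
Lemma cycle_kite_bound x : (forall v, v \in rcons p c -> x w <= x v) ->
  exists b, lowest x [set:: w :: rcons p c] w b /\
    3 * dist_form x [set:: w :: rcons p c]
      + 6 * kite_loss x [set:: w :: rcons p c] w b
    <= triple_form x [set:: w :: rcons p c].
Proof.
move=> wmin; rewrite set_cons set_rcons_c.
have wU : w \notin c |: [set:: p].
  by move: uniqwp; rewrite !inE negb_or eq_sym cw => /andP[].
have wp : w \notin [set:: p] by move: wU; rewrite !inE negb_or => /andP[].
have cU : c \notin [set:: p] by rewrite inE.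
have wmin' v : v \in c |: [set:: p] -> x w <= x v.
  by move=> vU; apply: wmin; move: vU; rewrite !inE mem_rcons inE.
have tree : 3 * dist_form x (c |: [set:: p]) <= triple_form x (c |: [set:: p]).
  rewrite -set_rcons_c; move: wpc uwpc; case: (rcons p c) => [|u q] /=.
    by rewrite set_nil /dist_form /triple_form !big_set0 mulr0.
  by rewrite rcons_path => /andP[_ /andP[uq _]] /andP[_ uuq]; apply: path_tree_form.
have [t tp] : exists t, t \in [set:: p].
  by case: p p0 => // t q _; exists t; rewrite !inE eqxx.
have star := path_star pathwp uniqwp; rewrite set_cons in star.
have := star_center_sqd x wp star tp; rewrite mulr0 mul0r addr0.
have [b bU bmin] : exists2 b, b \in c |: [set:: p] &
    forall v, v \in c |: [set:: p] -> x b <= x v.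
  by have [b bU bmin] := arg_minP x (setU11 c [set:: p]); exists b.
have bw : w != b by apply: contraNneq wU => ->.
move=> star_w; exists b; split.
  have bV := setU1r w bU; split; rewrite ?setU11 ?wmin' // => v.
  by case/setU1P => [->|vU _]; rewrite ?eqxx // bmin.
rewrite dist_form_setU1 // triple_form_setU1 // /kite_loss (big_setU1 _ wU) /= sqdxx add0r.
have : \sum_(v in c |: [set:: p]) \sum_(v' in c |: [set:: p]) Num.max (sqd x w v) (sqd x w v')
    <= \sum_(v in c |: [set:: p]) \sum_(v' in c |: [set:: p]) sqdiam x w v v'.
  by do 2![apply: ler_sum => ? _]; exact: sqdiam_ge_max.
rewrite sum2_setU1 //; last by move=> u' v; rewrite maxC.
rewrite !(big_setU1 _ cU) /= maxxx => diam_w.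
have dwcD : (d w c)%:R * sqd x w c <= sqd x w c.
  by rewrite -[leRHS]mul1r ler_wpM2r ?sqd_ge0 // lern1.
have mx : sqd x w c + \sum_(v in [set:: p]) sqd x w v - sqd x w b <=
    \sum_(v in [set:: p]) Num.max (sqd x w c) (sqd x w v).
  have termle v : sqd x w v <= Num.max (sqd x w c) (sqd x w v) by rewrite le_max lexx orbT.
  case/setU1P: bU => [->|bp].
    have : \sum_(v in [set:: p]) sqd x w v <=
       \sum_(v in [set:: p]) Num.max (sqd x w c) (sqd x w v) by apply: ler_sum.
    lra.
  rewrite !(big_setD1 b bp) /=.
  have : \sum_(v in [set:: p] :\ b) sqd x w v <=
     \sum_(v in [set:: p] :\ b) Num.max (sqd x w c) (sqd x w v) by apply: ler_sum.
  have : sqd x w c <= Num.max (sqd x w c) (sqd x w b) by rewrite le_max lexx.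
  lra.
lra.
Qed.

End CycleBase.

(** The invariant of the growth: the first three clauses are what preserves the last one when a
    vertex is added. *)
Definition kite_like V := [/\ (2 < #|V|)%N,
  {in V &, forall u v, ((d u v).+2 <= #|V|)%N},
  {in V, forall u, star_bound true V u} & kite_bound V].

Lemma kite_like_cycle s : ucycle e s -> (2 < size s)%N -> kite_like [set:: s].
Proof.
case/andP=> cs us s2.
have rotated w : w \in s -> exists c p,
    [/\ (0 < size p)%N, cycle e (w :: rcons p c), uniq (w :: rcons p c)
       & [set:: s] = [set:: w :: rcons p c]].
  case/rot_to => i s' sE.
  have sz : (size s').+1 = size s by rewrite -(size_rot i s) sE.
  case/lastP: s' sE sz => [|p c] sE sz; first by move: s2; rewrite -sz.
  exists c, p; rewrite -sE rot_cycle rot_uniq; split=> //.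
    by move: s2; rewrite -sz size_rcons !ltnS.
  by apply/setP => v; rewrite !inE mem_rot.
split.
- by rewrite cardsE (card_uniqP us).
- move=> u v; rewrite inE => /rotated[c [p [p0 cy un ->]]].
  exact: cycle_dist.
- by move=> u; rewrite inE => /rotated[c [p [p0 cy un ->]]]; apply: cycle_star.
move=> x; have [v0 v0s] : exists v, v \in s by case: (s) s2 => // v ? _; exists v; rewrite mem_head.
have [w ws wmin] : exists2 w, w \in s & forall v, v \in s -> x w <= x v.
  by have [w ws wmin] := arg_minP x v0s; exists w.
have [c [p [p0 cy un sE]]] := rotated w ws.
have [|b [l h]] := cycle_kite_bound p0 cy un (x := x).
  move=> v vp; apply: wmin; have := congr1 (fun V : {set T} => v \in V) sE.
  by rewrite /= !inE vp orbT.
by exists w, b; rewrite sE; split=> //; left.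
Qed.

Lemma kite_like_leaf V u z : z \notin V -> u \in V -> e u z ->
  kite_like V -> kite_like (z |: V).
Proof.
move=> zV uV uz [V2 dV stV kV]; have zu := edge_leaf (V := V) uz.
have dz v : v \in V -> ((d z v).+2 <= #|z |: V|)%N.
  by move=> vV; rewrite cardsU1 zV ltnS; apply: leq_ltn_trans (zu v vV) _; apply: dV.
split.
- by rewrite cardsU1 zV ltnW.
- move=> v w /setU1P[->|vV] /setU1P[->|wV].
  + by rewrite dxx cardsU1 zV ltnS ltnW // ltnW.
  + exact: dz.
  + by rewrite dC dz.
  + by apply: leq_trans (dV v w vV wV) _; rewrite cardsU1 leq_addl.
- move=> v /setU1P[->|vV].
    by apply: star_bound_center (stV u uV) => //; rewrite implyTb ltnW.
  exact: (star_bound_leaf zV uV vV zu (dV u v uV vV) (stV v vV)).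
- exact: (kite_bound_leaf zV uV V2 zu (stV u uV) kV).
Qed.

(** By connectedness an edge leaves every nonempty proper vertex set. Its outer end can be added as
    if it were pendant: [d] is fixed throughout and only upper bounds on it are used, so further
    edges at that vertex do no harm. *)
Lemma kite_like_connected s : (forall u v, connect e u v) ->
  ucycle e s -> (2 < size s)%N -> kite_like [set: T].
Proof.
move=> con cs s2; have [w ws] : exists w, w \in [set:: s].
  by case: (s) s2 => // v ? _; exists v; rewrite !inE eqxx.
have := kite_like_cycle cs s2; move: ws; move: [set:: s] => V.
have [k] := ubnP #|~: V|; elim: k V => // k IH V; rewrite ltnS => kV wV VK.
have [<- //|VT] := eqVneq V [set: T].
have [u [z [uV zV uz]]] : exists u z, [/\ u \in V, z \notin V & e u z].
  have [v vV] : exists v, v \notin V.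
    apply/existsP; rewrite -negb_forall; apply: contraNN VT => /forallP h.
    by apply/eqP/setP => v; rewrite h inE.
  have /connectP[p] := con w v; elim: p w wV {kV IH} => [|y p IHp] w wV /=.
    by move=> _ E; rewrite E wV in vV.
  case/andP=> wy yp vE; have [yV|yV] := boolP (y \in V); first exact: IHp yV yp vE.
  by exists w, y.
apply: (IH (z |: V)); last exact: kite_like_leaf uV uz VK.
- apply: leq_trans kV; apply: proper_card; rewrite properC; apply/properP.
  by split; [exact: subsetUr | exists z; rewrite ?setU11].
- by rewrite in_setU1 wV orbT.
Qed.

End Layers.

(** * Graph distance *)

Section GraphDistance.
Variables (T : finType) (e : rel T).
Implicit Types (u v z : T).

Lemma gdist_le_path u p : path e u p -> (gdist e u (last u p) <= size p)%N.
Proof.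
case/shortenP=> q uq uniq_q sub_q; apply: leq_trans (_ : size q <= _)%N.
  2: by apply: uniq_leq_size sub_q; case/andP: uniq_q.
have sz : (size q < #|T|)%N.
  by have := max_card [in u :: q]; rewrite (card_uniqP uniq_q).
rewrite leqNgt; apply/negP => /(before_find 0%N); rewrite nth_iota // add0n => /negbT/negP[].
apply/existsP; exists (in_tuple q).
by rewrite uq uniq_q eqxx.
Qed.

Lemma gdist_path u v : connect e u v ->
  exists p, [/\ path e u p, last u p = v & size p = gdist e u v].
Proof.
case/connectP=> p; case/shortenP=> q uq uniq_q _ ->.
have sz : (size q < #|T|)%N.
  by have := max_card [in u :: q]; rewrite (card_uniqP uniq_q).
have lt : (gdist e u (last u q) < size (iota 0 #|T|))%N.
  by rewrite size_iota (leq_ltn_trans _ sz) // gdist_le_path.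
move: lt; rewrite /gdist -has_find => /(nth_find 0%N) lt.
have := nth_iota 0 0 (_ : (gdist e u (last u q) < #|T|)%N).
rewrite -/(gdist e u _) in lt *.
rewrite add0n => E; rewrite {}E in lt; last first.
  exact: leq_ltn_trans (gdist_le_path uq) sz.
case/existsP: lt => r /and3P[ur _ /eqP rE].
by exists r; rewrite size_tuple.
Qed.

Lemma gdist_xx u : gdist e u u = 0%N.
Proof. by apply/eqP; rewrite -leqn0; apply: (@gdist_le_path u [::]). Qed.

Lemma gdist_gt0 u v : u != v -> (0 < gdist e u v)%N.
Proof.
move=> uv; case: (boolP (connect e u v)) => [/gdist_path[p [_ vE <-]]|nuv].
  by case: p vE uv => //= ->; rewrite eqxx.
rewrite lt0n; apply: contraNneq nuv => E; apply/connectP.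
have T0 : (0 < #|T|)%N by apply/card_gt0P; exists u.
have : has (has_path_of_length e u v) (iota 0 #|T|).
  by rewrite has_find -/(gdist e u v) E size_iota.
move/(nth_find 0%N); rewrite -/(gdist e u v) E nth_iota //.
by case/existsP=> r /and3P[ur _ /eqP rE]; exists r.
Qed.

Lemma gdist_edge u z v : symmetric e -> e u z -> (gdist e z v <= (gdist e u v).+1)%N.
Proof.
move=> eC uz; case: (boolP (connect e u v)) => [/gdist_path[p [up vE <-]]|nuv].
  by have := @gdist_le_path z (u :: p); rewrite /= eC uz up vE; apply.
(* Without a connecting path [gdist] takes its default value [#|T|], which no other value
   exceeds. *)
have -> : gdist e u v = #|T|.
  rewrite /gdist hasNfind ?size_iota //; apply/hasPn => k _.
  apply: contraNN nuv => /existsP[r /and3P[ur _ /eqP rE]].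
  by apply/connectP; exists r.
by rewrite /gdist ltnW // ltnS -[leqRHS](size_iota 0) find_size.
Qed.

Lemma gdist_lipschitz (f : T -> nat) u v : (forall a b, e a b -> (f b <= (f a).+1)%N) ->
  connect e u v -> (f v <= f u + gdist e u v)%N.
Proof.
move=> f_lip /gdist_path[p [up <- <-]]; elim: p u up => [|z p IH] u /=; first by rewrite addn0.
by case/andP=> uz zp; have := IH z zp; have := f_lip u z uz; lia.
Qed.

End GraphDistance.

Section GraphIso.
Variables (T T' : finType) (e : rel T) (e' : rel T').

Lemma gdist_hom (f : T -> T') u v : (forall a b, e a b -> e' (f a) (f b)) ->
  connect e u v -> (gdist e' (f u) (f v) <= gdist e u v)%N.
Proof.
move=> fe /gdist_path[p [up <- <-]].
rewrite -(size_map f) -last_map; apply: gdist_le_path.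
by rewrite path_map; apply: sub_path up.
Qed.

End GraphIso.

Section Kite.
Variable n : nat.
Hypothesis n3 : (2 < n)%N.
Local Notation k3 := (@kite3 n).

Lemma kite3_sym : symmetric k3.
Proof. by move=> i j; rewrite /kite3 eq_sym andbC (andbC (i < 3)%N) [X in _ || X]orbC andbC. Qed.

(** Merging the twins [0] and [1] makes the label change by at most one along every edge, so that
    differences of levels bound distances from below. *)
Definition kite_level (i : 'I_n) : nat := maxn i 1.

Lemma kite_level_lip i j : k3 i j -> (kite_level j <= (kite_level i).+1)%N.
Proof. by rewrite /kite3 /kite_level => /andP[_ /or3P[/andP[]|/eqP|/eqP]]; lia. Qed.

Lemma kite_connect i j : connect k3 i j.
Proof.
suff H (k : nat) (i0 : 'I_n) : forall j : 'I_n, j = (i0 + k)%N :> nat -> connect k3 i0 j.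
  have [ij|ji] := leqP i j; first by apply: (H (j - i)%N); lia.
  by rewrite (sym_connect_sym kite3_sym) (H (i - j)%N) //; lia.
elim: k => [|k IH] {}j jE; first by rewrite (_ : j = i0) //; apply: val_inj; rewrite /= jE addn0.
have lt : (i0 + k < n)%N by have := ltn_ord j; lia.
apply: connect_trans (IH (Ordinal lt) _) _ => //.
apply: connect1; rewrite /kite3 -val_eqE /= jE; apply/andP; split; first by apply/eqP; lia.
by apply/or3P; apply: Or32; apply/eqP; lia.
Qed.

Lemma kite_gdist_ge i j : (kite_level j <= kite_level i + gdist k3 i j)%N.
Proof. exact: gdist_lipschitz kite_level_lip (kite_connect i j). Qed.

Lemma kite_gdist_le (i j : 'I_n) : (i <= j)%N -> (gdist k3 i j <= j - i)%N.
Proof.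
move=> ij; have [k jE] : exists k, j = (i + k)%N :> nat by exists (j - i)%N; lia.
rewrite (_ : (j - i)%N = k); last by lia.
elim: k j jE {ij} => [|k IH] j jE.
  by rewrite (_ : j = i) ?gdist_xx //; apply: val_inj; rewrite /= jE addn0.
have lt : (i + k < n)%N by have := ltn_ord j; lia.
rewrite gdistC; last exact: kite3_sym.
apply: leq_trans (gdist_edge _ kite3_sym (_ : k3 (Ordinal lt) j)) _.
  rewrite /kite3 -val_eqE /= jE; apply/andP; split; first by apply/eqP; lia.
  by apply/or3P; apply: Or32; apply/eqP; lia.
by rewrite gdistC ?ltnS ?IH //; exact: kite3_sym.
Qed.

Lemma kite_gdistE (i j : 'I_n) : (0 < i)%N -> (i <= j)%N -> gdist k3 i j = (j - i)%N.
Proof.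
move=> i0 ij; have := kite_gdist_le ij; have := kite_gdist_ge i j.
by rewrite /kite_level; lia.
Qed.

Lemma kite_gdist0 (i j : 'I_n) : i = 0%N :> nat -> (1 < j)%N -> gdist k3 i j = j.-1.
Proof.
move=> i0 j1; apply/eqP; rewrite eqn_leq; apply/andP; split; last first.
  by have := kite_gdist_ge i j; rewrite /kite_level; lia.
(* [Ordinal n3] is the vertex [2], through which a shortest path from [0] to [j] runs. *)
have i2 : k3 (Ordinal n3) i by rewrite /kite3 -val_eqE /= i0.
apply: leq_trans (gdist_edge _ kite3_sym i2) _.
have := @kite_gdist_le (Ordinal n3) j; move=> /(_ j1) /=; lia.
Qed.

Lemma kite_gdist01 (i j : 'I_n) : i = 0%N :> nat -> j = 1%N :> nat -> gdist k3 i j = 1%N.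
Proof.
move=> i0 j1; apply/eqP; rewrite eqn_leq gdist_gt0 ?andbT; last first.
  by rewrite -val_eqE /= i0 j1.
by have := @kite_gdist_le i j; rewrite i0 j1; apply.
Qed.

End Kite.

(** * Rayleigh quotients *)

Section Rayleigh.
Import numFieldNormedType.Exports.
Variables (R : realType) (n : nat) (A : 'M[R]_n).
Hypothesis symA : A^T = A.
Implicit Types v w : 'rV[R]_n.

Definition mxform (B : 'M[R]_n) v w : R := (v *m B *m w^T) 0 0.

Lemma mxformE B v w : mxform B v w = \sum_(j < n) (\sum_(i < n) v 0 i * B i j) * w 0 j.
Proof.
by rewrite /mxform mxE; apply: eq_bigr => j _; rewrite !mxE.
Qed.

Lemma mxformDl B u v w : mxform B (u + v) w = mxform B u w + mxform B v w.
Proof. by rewrite /mxform !mulmxDl mxE. Qed.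

Lemma mxformDr B u v w : mxform B w (u + v) = mxform B w u + mxform B w v.
Proof. by rewrite /mxform linearD mulmxDr mxE. Qed.

Lemma mxformZl B a v w : mxform B (a *: v) w = a * mxform B v w.
Proof. by rewrite /mxform -!scalemxAl mxE. Qed.

Lemma mxformZr B a v w : mxform B v (a *: w) = a * mxform B v w.
Proof. by rewrite /mxform linearZ -!scalemxAr mxE. Qed.

Lemma mxform1 v : mxform 1%:M v v = \sum_i v 0 i ^+ 2.
Proof. by rewrite /mxform mulmx1 mxE; apply: eq_bigr => i _; rewrite mxE. Qed.

Lemma mxform1_ge0 v : 0 <= mxform 1%:M v v.
Proof. by rewrite mxform1 sumr_ge0 // => i _; exact: sqr_ge0. Qed.

Lemma mxform1_eq0 v : mxform 1%:M v v = 0 -> v = 0.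
Proof.
rewrite mxform1 => /eqP; rewrite psumr_eq0 => [/allP H|i _]; last exact: sqr_ge0.
apply/rowP => i; rewrite mxE; apply/eqP.
by have := H i (mem_index_enum i); rewrite implyTb sqrf_eq0.
Qed.

Lemma mxform_cst a v w : mxform a%:M v w = a * mxform 1%:M v w.
Proof. by rewrite /mxform mul_mx_scalar -scalemxAl mulmx1 mxE. Qed.

Lemma mxformB B C v w : mxform (B - C) v w = mxform B v w - mxform C v w.
Proof. by rewrite /mxform mulmxBr mulmxBl !mxE. Qed.

Lemma mxformC B v w : B^T = B -> mxform B v w = mxform B w v.
Proof.
move=> symB; rewrite /mxform; have <- : (v *m B *m w^T)^T = w *m B *m v^T.
  by rewrite !trmx_mul trmxK symB mulmxA.
by rewrite [RHS]mxE.
Qed.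

(* Moving from [v] in the direction [- v *m B] would make the form negative. *)
Lemma psd_kernel (B : 'M[R]_n) v : B^T = B ->
  (forall w, 0 <= mxform B w w) -> mxform B v v = 0 -> v *m B = 0.
Proof.
move=> symB psd v0; pose w := v *m B; apply: mxform1_eq0; rewrite -/w.
have ww : mxform B v w = mxform 1%:M w w by rewrite /mxform mulmx1.
set s := mxform 1%:M w w in ww *; set q := mxform B w w.
have s0 : 0 <= s by exact: mxform1_ge0.
have q0 : 0 <= q by exact: psd.
have qp : 0 < q + 1 by lra.
(* The denominator [q + 1] is positive even if [q = 0]. With [t = s / (q + 1)] the form at this
   vector equals [- t ^ 2 * (q + 2)], so [t = 0]. *)
have := psd (v + (- (s / (q + 1))) *: w).
rewrite !(mxformDl, mxformDr, mxformZl, mxformZr) v0 (mxformC w v symB) ww -/q.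
set t := s / (q + 1); have sE : s = t * (q + 1) by rewrite /t divfK // gt_eqF.
have t0 : 0 <= t by rewrite /t divr_ge0 // ltW.
rewrite sE => h.
have : t * t * (q + 2) <= 0 by nra.
move=> h2; have : t * t <= 0 by nra.
move=> h3; have -> : t = 0 by nra.
by rewrite mul0r.
Qed.

Lemma continuous_sum (I : Type) (r : seq I) (F : I -> 'rV[R]_n -> R) :
  (forall i, continuous (F i)) -> continuous (fun v => \sum_(i <- r) F i v).
Proof.
move=> Fc; elim: r => [|i r IH].
  rewrite (_ : (fun v => _) = fun=> 0); first by move=> v; exact: cst_continuous.
  by apply/funext => v; rewrite big_nil.
rewrite (_ : (fun v => _) = F i \+ (fun v => \sum_(i <- r) F i v)).
  by move=> v; apply: continuousD; [exact: Fc | exact: IH].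
by apply/funext => v; rewrite big_cons.
Qed.

Lemma mxform_continuous B : continuous (fun v => mxform B v v).
Proof.
rewrite (_ : (fun v => _) = fun v => \sum_(j < n) \sum_(i < n) (v 0 i * B i j) * v 0 j).
  apply: continuous_sum => j; apply: continuous_sum => i v.
  have vi k : {for v, continuous (fun v : 'rV[R]_n => v 0 k)}.
    exact: coord_continuous.
  have vB : {for v, continuous (fun v : 'rV[R]_n => v 0 i * B i j)}.
    exact: (continuousM (vi i) (@cst_continuous _ _ (B i j) v)).
  exact: (continuousM vB (vi j)).
by apply/funext => v; rewrite mxformE; apply: eq_bigr => j _; rewrite mulr_suml.
Qed.

Lemma sphere_compact : compact [set v | mxform 1%:M v v = 1]%classic.
Proof.
apply: bounded_closed_compact.
  exists 1; split => // M M1 v /= v1; rewrite [leLHS]/Num.norm /= mx_normrE.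
  apply/bigmax_leP; split=> [|[i j] _ /=]; first by lra.
  apply: le_trans (ltW M1); rewrite ord1.
  have : v 0 j ^+ 2 <= 1.
    rewrite -v1 mxform1 (bigD1 j) //= lerDl sumr_ge0 // => *; exact: sqr_ge0.
  by rewrite -real_normK ?num_real // expr_le1.
rewrite (_ : [set v | _]%classic = ((fun v => mxform 1%:M v v) @^-1` [set 1])%classic) //.
apply: closed_comp; last exact: closed_eq.
by move=> v _; exact: mxform_continuous.
Qed.

(** By compactness the form attains a maximum [m] on the unit sphere. The form of [m%:M - A] is then
    nonnegative and vanishes at the maximiser, which is therefore an eigenvector for [m]. *)
Lemma rayleigh lam : (0 < n)%N ->
    (forall a, eigenvalue A a -> a <= lam) ->
  forall v, mxform A v v <= lam * mxform 1%:M v v.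
Proof.
move=> n0 lamax.
have S0 : ([set v | mxform 1%:M v v = 1] !=set0)%classic.
  exists (delta_mx 0 (Ordinal n0)); rewrite /= mxform1 (bigD1 (Ordinal n0)) //= !mxE !eqxx /=.
  rewrite expr1n big1 ?addr0 // => i /negbTE ne; rewrite mxE ne andbF expr0n //.
have [v0 v0S vmax] : exists2 c, c \in [set v | mxform 1%:M v v = 1]%classic &
    forall t, t \in [set v | mxform 1%:M v v = 1]%classic -> mxform A t t <= mxform A c c.
  apply: EVT_max_rV S0 sphere_compact _.
  by apply: continuous_subspaceT => v; exact: mxform_continuous.
move: v0S => /set_mem /= v0S; set m := mxform A v0 v0 in vmax.
have bound v : mxform A v v <= m * mxform 1%:M v v.
  have [v_0|vn0] := eqVneq (mxform 1%:M v v) 0.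
    by rewrite (mxform1_eq0 v_0) /mxform !mul0mx mxE mulr0.
  set s := mxform 1%:M v v in vn0 *.
  have s0 : 0 < s by rewrite lt_def vn0 mxform1_ge0.
  pose w := (Num.sqrt s)^-1 *: v.
  have sq : (Num.sqrt s)^-1 * (Num.sqrt s)^-1 = s^-1.
    by rewrite -expr2 exprVn sqr_sqrtr // ltW.
  have /vmax : w \in [set v | mxform 1%:M v v = 1]%classic.
    by apply: mem_set; rewrite /= !(mxformZl, mxformZr) mulrA sq -/s mulVf.
  rewrite !(mxformZl, mxformZr) mulrA sq ler_pdivrMl // mulrC; lra.
have symB : (m%:M - A)^T = m%:M - A by rewrite linearB /= tr_scalar_mx symA.
have ker : v0 *m (m%:M - A) = 0.
  apply: psd_kernel => // [w|]; rewrite mxformB mxform_cst ?subr_ge0 //.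
  by rewrite v0S mulr1 subrr.
have m_eig : eigenvalue A m.
  apply/eigenvalueP; exists v0.
    by apply/eqP; rewrite eq_sym -subr_eq0 -mul_mx_scalar -mulmxBr ker.
  apply: contra_eq_neq v0S => ->; rewrite mxform1 big1 1?eq_sym ?oner_neq0 // => i _.
  by rewrite mxE expr0n.
move=> v; apply: le_trans (bound v) _.
by rewrite ler_wpM2r ?mxform1_ge0 // lamax.
Qed.

Lemma rayleigh_eq lam v : (forall w, mxform A w w <= lam * mxform 1%:M w w) ->
  mxform A v v = lam * mxform 1%:M v v -> v *m A = lam *: v.
Proof.
move=> H Hv; have symB : (lam%:M - A)^T = lam%:M - A.
  by rewrite linearB /= tr_scalar_mx symA.
have ker : v *m (lam%:M - A) = 0.
  apply: psd_kernel => // [w|]; rewrite mxformB mxform_cst ?subr_ge0 //.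
  by rewrite Hv subrr.
by apply/eqP; rewrite eq_sym -subr_eq0 -mul_mx_scalar -mulmxBr ker.
Qed.

End Rayleigh.

(** * The distance form and the spectral radius *)

Section Spectrum.
Variables (R : realType) (T : finType) (e : rel T).
Hypotheses (eC : symmetric e) (T0 : (0 < #|T|)%N).
Implicit Types x : T -> R.

Definition lap_eigenvector (lam : R) x :=
  forall u, \sum_v (gdist e u v)%:R * (x u - x v) = lam * x u.

Let vec x : 'rV[R]_#|T| := \row_i x (enum_val i).

Lemma sum_enum_val (F : T -> R) : \sum_(i < #|T|) F (enum_val i) = \sum_t F t.
Proof.
rewrite [RHS](reindex_onto enum_val enum_rank) /= => [|t _]; last exact: enum_rankK.
by apply: eq_bigl => i; rewrite enum_valK eqxx.
Qed.

Lemma vec_dist_lap x (j : 'I_#|T|) :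
  (vec x *m dist_lap R e) 0 j =
  \sum_v (gdist e (enum_val j) v)%:R * (x (enum_val j) - x v).
Proof.
rewrite mxE; under eq_bigr => i _ do rewrite !mxE mulrBr.
rewrite sumrB (bigD1 j) //= eqxx mulr1n [X in _ + X - _]big1 ?addr0 => [|i /negbTE ij]; last first.
  by rewrite ij mulr0n mulr0.
rewrite /transmission natr_sum mulr_sumr.
have -> : \sum_(i < #|T|) x (enum_val i) * (gdist e (enum_val i) (enum_val j))%:R
   = \sum_v x v * (gdist e v (enum_val j))%:R by rewrite -sum_enum_val.
by rewrite -sumrB; apply: eq_bigr => v _; rewrite (gdistC eC v) mulrBr ![_%:R * _]mulrC.
Qed.

Lemma mxform_dist_lap x :
  2 * mxform (dist_lap R e) (vec x) (vec x) = dist_form (gdist e) x [set: T].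
Proof.
have -> : mxform (dist_lap R e) (vec x) (vec x) =
    \sum_u \sum_v (gdist e u v)%:R * (x u - x v) * x u.
  rewrite /mxform mxE -sum_enum_val; apply: eq_bigr => j _.
  by rewrite vec_dist_lap !mxE mulr_suml.
rewrite /dist_form; under [RHS]eq_bigl do rewrite inE.
under [RHS]eq_bigr do (under eq_bigl do rewrite inE).
rewrite mulr_natl mulr2n [X in _ + X]exchange_big /= -big_split /=.
apply: eq_bigr => u _; rewrite -big_split /=; apply: eq_bigr => v _.
rewrite (gdistC eC v u) /sqd; ring.
Qed.

Lemma mxform1_vec x : mxform 1%:M (vec x) (vec x) = \sum_t x t ^+ 2.
Proof. by rewrite mxform1 -sum_enum_val; apply: eq_bigr => i _; rewrite mxE. Qed.

Let symA : (dist_lap R e)^T = dist_lap R e.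
Proof.
apply/matrixP => i j; rewrite !mxE (gdistC eC); congr (_ - _).
by have [->|ij] := eqVneq i j; rewrite // eq_sym (negbTE ij) !mulr0n.
Qed.

Lemma dist_form_le_radius x :
  dist_form (gdist e) x [set: T] <= 2 * dist_lap_radius R e * \sum_t x t ^+ 2.
Proof.
have [_ lmax] := dist_lap_radiusP R eC T0.
rewrite -mxform_dist_lap -mxform1_vec -mulrA ler_pM2l //.
exact: rayleigh.
Qed.

Lemma radius_eigenvector x :
    dist_form (gdist e) x [set: T] = 2 * dist_lap_radius R e * \sum_t x t ^+ 2 ->
  lap_eigenvector (dist_lap_radius R e) x.
Proof.
have [_ lmax] := dist_lap_radiusP R eC T0.
rewrite -mxform_dist_lap -mxform1_vec -mulrA => H u.
have H' := mulfI (_ : (2 : R) != 0) H; move: H'; rewrite pnatr_eq0 => /(_ isT) H'.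
have /rowP/(_ (enum_rank u)) := rayleigh_eq symA (rayleigh symA T0 lmax) H'.
by rewrite vec_dist_lap !mxE enum_rankK.
Qed.

Lemma eigenvector_ex : exists2 x,
  lap_eigenvector (dist_lap_radius R e) x & exists t, x t != 0.
Proof.
have [/eigenvalueP[v vA v0] _] := dist_lap_radiusP R eC T0.
pose x t := v 0 (enum_rank t).
have vE : v = vec x by apply/rowP => i; rewrite mxE /x enum_valK.
exists x => [u|].
  by have /rowP/(_ (enum_rank u)) := vA; rewrite {1}vE vec_dist_lap !mxE enum_rankK.
have /rV0Pn[i vi] := v0; exists (enum_val i); by rewrite /x enum_valK.
Qed.

Lemma dist_form_eigenvector lam x : lap_eigenvector lam x ->
  dist_form (gdist e) x [set: T] = 2 * lam * \sum_t x t ^+ 2.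
Proof.
move=> xe; rewrite -mxform_dist_lap -mulrA; congr (_ * _).
rewrite /mxform mxE -sum_enum_val mulr_sumr; apply: eq_bigr => j _.
by rewrite vec_dist_lap xe !mxE expr2 mulrA.
Qed.

Lemma sum_sqr_gt0 x t : x t != 0 -> 0 < \sum_t x t ^+ 2.
Proof.
move=> xt; rewrite (bigD1 t) //=; apply: ltr_pwDl; first by rewrite exprn_even_gt0.
by apply: sumr_ge0 => *; exact: sqr_ge0.
Qed.

Lemma lap_eigenvectorN lam x : lap_eigenvector lam x -> lap_eigenvector lam (\- x).
Proof.
move=> xe u /=; rewrite mulrN -xe -sumrN; apply: eq_bigr => v _; ring.
Qed.

End Spectrum.

(** * The kite *)

Section SortedVertices.
Variables (R : realFieldType) (n : nat).
Implicit Types (y : 'I_n -> R) (i j : 'I_n).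

Definition initial (k : nat) : {set 'I_n} := [set i : 'I_n | (i < k)%N].

Lemma initial0 : initial 0 = set0.
Proof. by apply/setP => i; rewrite !inE. Qed.

Lemma initialS k (lt : (k < n)%N) : initial k.+1 = Ordinal lt |: initial k.
Proof. by apply/setP => i; rewrite !inE -val_eqE /= ltnS leq_eqVlt. Qed.

Lemma notin_initial k (lt : (k < n)%N) : Ordinal lt \notin initial k.
Proof. by rewrite inE /= ltnn. Qed.

Lemma initial_full : initial n = [set: 'I_n].
Proof. by apply/setP => i; rewrite !inE ltn_ord. Qed.

(** The maximum over a pair is the value at the smaller index, and [i] is the smaller index of
    [2 * (k - i) - 1] ordered pairs, the pair [(i, i)] included. *)
Lemma sum_max_antitone y k : (k <= n)%N ->
    (forall i j, (i <= j)%N -> (j < k)%N -> y j <= y i) ->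
  \sum_(i in initial k) \sum_(j in initial k) Num.max (y i) (y j)
    + \sum_(i in initial k) y i = 2 * \sum_(i in initial k) (k - i)%:R * y i.
Proof.
elim: k => [|k IH] kn anti; first by rewrite initial0 !big_set0; lra.
rewrite (initialS kn) sum2_setU1 ?notin_initial //; last by move=> *; rewrite maxC.
rewrite !big_setU1 ?notin_initial //= maxxx subSnn.
have E1 : \sum_(v in initial k) Num.max (y (Ordinal kn)) (y v) = \sum_(v in initial k) y v.
  apply: eq_bigr => i; rewrite inE => ik; apply/max_idPr; apply: anti => //=.
  exact: ltnW.
have E2 : \sum_(i in initial k) (k.+1 - i)%:R * y i =
    \sum_(i in initial k) (k - i)%:R * y i + \sum_(i in initial k) y i.
  rewrite -big_split /=; apply: eq_bigr => i; rewrite inE => ik.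
  by rewrite subSn 1?ltnW // -natr1 mulrDl mul1r.
have := IH (ltnW kn) (fun i j ij jk => anti i j ij (ltnW jk)).
rewrite E1 E2; lra.
Qed.

Definition line_dist i j := ((i - j) + (j - i))%N.

(* Adding the vertices in increasing order, the triples with the newest vertex
   [z] reduce to maxima of squared distances to [z], which are sorted. *)
Lemma triple_form_sorted y k : (k <= n)%N ->
    (forall i j, (i <= j)%N -> y i <= y j) ->
  triple_form y (initial k) = 3 * dist_form line_dist y (initial k).
Proof.
move=> kn mono; elim: k kn => [|k IH] kn.
  by rewrite initial0 /triple_form /dist_form !big_set0 mulr0.
have lineC i j : line_dist i j = line_dist j i by rewrite /line_dist addnC.
rewrite (initialS kn) triple_form_setU1 ?(dist_form_setU1 lineC) ?notin_initial //.
set z := Ordinal kn.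
have -> : \sum_(v in initial k) \sum_(w in initial k) sqdiam y z v w =
    \sum_(v in initial k) \sum_(w in initial k) Num.max (sqd y z v) (sqd y z w).
  apply: eq_bigr => i; rewrite inE => ik; apply: eq_bigr => j; rewrite inE => jk.
  have iz : y i <= y z by apply: mono; rewrite ltnW.
  have jz : y j <= y z by apply: mono; rewrite ltnW.
  rewrite /sqdiam maxA; apply/max_idPl; rewrite le_max.
  have [ij|ji] := leP (y i) (y j); apply/orP; [left|right].
    by rewrite (sqdC y z) sqd_le //; lra.
  by rewrite (sqdC y z) (sqdC y i) sqd_le //; lra.
have anti : forall i j, (i <= j)%N -> (j < k)%N -> sqd y z j <= sqd y z i.
  move=> i j ij jk; have jz : y j <= y z by apply: mono; rewrite ltnW.
  by rewrite sqdC (sqdC y z) sqd_le //; have := mono i j ij; lra.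
rewrite (sum_max_antitone (ltnW kn) anti) IH 1?ltnW //.
under [X in _ = 3 * (_ + 2 * X)]eq_bigr => i ik.
  move: ik; rewrite inE => ik.
  rewrite (_ : line_dist z i = k - i)%N; last by rewrite /line_dist /=; lia.
  over.
lra.
Qed.

Hypothesis n3 : (2 < n)%N.
Let i0 : 'I_n := Ordinal (ltnW (ltnW n3)).
Let i1 : 'I_n := Ordinal (ltnW n3).

(** The kite is the path with the additional edge between [0] and [2], which shortens by one exactly
    the distances from [0] to the vertices from [2] on. *)
Lemma line_le_kite y :
  dist_form line_dist y [set: 'I_n] =
  dist_form (gdist (@kite3 n)) y [set: 'I_n] + 2 * kite_loss y [set: 'I_n] i0 i1.
Proof.
have lineC i j : line_dist i j = line_dist j i by rewrite /line_dist addnC.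
have kC : forall i j, gdist (@kite3 n) i j = gdist (@kite3 n) j i.
  by apply: gdistC; exact: kite3_sym.
pose W := [set: 'I_n] :\ i0; have TE : [set: 'I_n] = i0 |: W by rewrite setD1K ?inE.
have i0W : i0 \notin W by rewrite !inE eqxx.
have posW i : i \in W -> (0 < i)%N by rewrite !inE andbT -val_eqE /= lt0n.
have i1W : i1 \in W by rewrite !inE.
rewrite TE (dist_form_setU1 lineC) // (dist_form_setU1 kC) //.
have -> : dist_form line_dist y W = dist_form (gdist (@kite3 n)) y W.
  apply: eq_bigr => i /posW i_0; apply: eq_bigr => j /posW j_0; congr (_%:R * _).
  have [ij|/ltnW ji] := leqP i j.
    by rewrite kite_gdistE // /line_dist; move: ij; lia.
  by rewrite kC kite_gdistE // /line_dist; move: ji; lia.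
rewrite /kite_loss big_setU1 //= sqdxx add0r !(big_setD1 i1 i1W) /=.
have -> : line_dist i0 i1 = 1%N by [].
have -> : gdist (@kite3 n) i0 i1 = 1%N by rewrite kite_gdist01.
have -> : \sum_(j in W :\ i1) (line_dist i0 j)%:R * sqd y i0 j =
    \sum_(j in W :\ i1) (gdist (@kite3 n) i0 j)%:R * sqd y i0 j
    + \sum_(j in W :\ i1) sqd y i0 j.
  rewrite -big_split /=; apply: eq_bigr => j /setD1P[j1 /posW j0].
  have j2 : (1 < j)%N by move: j1; rewrite -val_eqE /= => /eqP; lia.
  rewrite kite_gdist0 // -[X in _ = _ + X]mul1r -mulrDl natr1 prednK //.
  by rewrite /line_dist /= sub0n add0n subn0.
lra.
Qed.

(** This is equality in [star_bound true], centred at the tip [l] of the kite with the twin [0] as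
    [t]. Indeed [n - i] exceeds the distance to [l] by one, and by two at [0]. *)
Lemma sum_max_kite (Y : 'I_n -> R) (l : 'I_n) : l = n.-1 :> nat ->
    (forall i j, (i <= j)%N -> Y j <= Y i) ->
  \sum_(i in [set: 'I_n]) \sum_(j in [set: 'I_n]) Num.max (Y i) (Y j) =
  2 * \sum_(i in [set: 'I_n]) (gdist (@kite3 n) l i)%:R * Y i
    + \sum_(i in [set: 'I_n]) Y i + 2 * Y i0.
Proof.
move=> lE anti; have kC := gdistC (@kite3_sym n).
have dk i : ((n - i)%:R : R) = (gdist (@kite3 n) l i)%:R + 1 + (i == i0)%:R.
  rewrite -[1]/(1%:R) -!natrD; congr _%:R; have [->|ne] := eqVneq i i0.
    by rewrite kC kite_gdist0 //= lE; lia.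
  have ip : (0 < i)%N by move: ne; rewrite -val_eqE /= lt0n.
  by rewrite kC kite_gdistE ?lE //; have := ltn_ord i; lia.
have := sum_max_antitone (leqnn n) (fun i j ij _ => anti i j ij); rewrite initial_full.
under [X in _ = 2 * X]eq_bigr => i _ do rewrite dk !mulrDl mul1r.
rewrite !big_split /= [X in _ + _ + X](big_setD1 i0) ?inE //= mul1r.
rewrite [X in Y i0 + X]big1 => [|i /setD1P[/negbTE-> _]]; last by rewrite mul0r.
lra.
Qed.

End SortedVertices.

(** * Strict increase next to the twins of the kite *)

Section KiteEigenvector.
Variables (R : realFieldType) (n : nat) (lam : R) (y : 'I_n -> R).
Hypotheses (n4 : (3 < n)%N) (mono : forall i j : 'I_n, (i <= j)%N -> y i <= y j).
Hypothesis eig : forall i, \sum_j (gdist (@kite3 n) i j)%:R * (y i - y j) = lam * y i.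

(** If the values at [1] and [2] agreed, subtracting their two equations would make [y] constant on
    the positive vertices. The equations at [1] and at the tip, whose distances to [0] differ
    because [n] is at least 4, would then force [y = 0]. *)
Lemma kite_eigenvector_lt (i j : 'I_n) : lam != 0 -> (exists t, y t != 0) ->
  i = 1%N :> nat -> j = 2%N :> nat -> y i < y j.
Proof.
move=> lam0 [t yt] iE jE.
have n3 : (2 < n)%N by exact: ltnW.
have kC : forall i j, gdist (@kite3 n) i j = gdist (@kite3 n) j i.
  by apply: gdistC; exact: kite3_sym.
have ij : y i <= y j by apply: mono; rewrite iE jE.
rewrite lt_neqAle ij andbT; apply/eqP => yij.
pose o : 'I_n := Ordinal (ltnW (ltnW n3)).
have ln : (n.-1 < n)%N by lia.
pose l : 'I_n := Ordinal ln.
have term k : ((gdist (@kite3 n) i k)%:R - (gdist (@kite3 n) j k)%:R) * (y i - y k)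
    = if (2 < k)%N then y i - y k else 0.
  case: ltnP => k2.
    rewrite !kite_gdistE ?iE ?jE //; [|lia..].
    have -> : (k - 1)%N = (k - 2).+1 by lia.
    by rewrite -natr1 addrAC subrr add0r mul1r.
  have [k0|kn0] := posnP k.
    by rewrite kC (kC j) kite_gdist01 // kite_gdist0 ?jE // subrr mul0r.
  suff -> : y k = y i by rewrite subrr mulr0.
  have [k1|k1] := eqVneq (k : nat) 1%N.
    by congr y; apply: val_inj; rewrite /= k1 iE.
  rewrite yij; congr y; apply: val_inj; rewrite /= jE; lia.
have sum0 : \sum_(k : 'I_n) (if (2 < k)%N then y i - y k else 0) = 0.
  have := eig j; rewrite -yij -(eig i) => /eqP; rewrite -subr_eq0 -sumrB => /eqP h.
  apply: oppr_inj; rewrite oppr0 -[RHS]h -sumrN; apply: eq_bigr => k _.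
  by rewrite -term mulrBl opprB.
have yl : y l = y i.
  have il : y i <= y l by apply: mono; rewrite iE /=; lia.
  apply/eqP; rewrite eq_le il andbT.
  rewrite -subr_ge0 -sum0 (bigD1 l) //= ifT; last by lia.
  rewrite gerDl; apply: sumr_le0 => k _; case: ifP => // k2.
  by rewrite subr_le0 mono // iE; lia.
have yk (k : 'I_n) : (0 < k)%N -> y k = y i.
  move=> k0; apply/eqP; rewrite eq_le (mono (i := i)) ?iE // -yl mono //=.
  by have := ltn_ord k; lia.
have eq_o (k : 'I_n) : (0 < k)%N -> (gdist (@kite3 n) k o)%:R * (y i - y o) = lam * y i.
  move=> k0; rewrite -(yk k k0) -eig (bigD1 o) //= big1 ?addr0 //.
  by move=> v vo; rewrite (yk v) ?yk ?subrr ?mulr0 //; move: vo; rewrite -val_eqE /= lt0n.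
have oi : y i - y o = 0.
  have hi := eq_o i; rewrite iE kC kite_gdist01 // mul1r in hi.
  have hl := eq_o l; rewrite kC kite_gdist0 //= in hl; last by lia.
  have l0 : (0 < n.-1)%N by lia.
  have := hl l0; rewrite -(hi isT) => /eqP; rewrite -subr_eq0 -{2}[y i - y o]mul1r -mulrBl.
  rewrite mulf_eq0 => /orP[|/eqP//].
  by rewrite subr_eq0 pnatr_eq1 => /eqP; lia.
have yi0 : y i = 0.
  have := eq_o i; rewrite iE oi mulr0 => /(_ isT)/esym/eqP.
  by rewrite mulf_eq0 (negbTE lam0) => /eqP.
have yo0 : y o = 0 by move: oi; rewrite yi0 sub0r => /eqP; rewrite oppr_eq0 => /eqP.
case/eqP: yt; have [t0|tn0] := posnP t; last by rewrite yk.
by rewrite -yo0; congr y; apply: val_inj.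
Qed.

End KiteEigenvector.

(** * Recognising a kite by its distances from the tip *)

Section KiteRecognition.
Variables (n : nat) (T : finType) (e : rel T) (a b c : T) (s : seq T).
Hypotheses (eC : symmetric e) (eI : irreflexive e) (con : forall u v, connect e u v).
Hypotheses (Tn : #|T| = n) (n3 : (2 < n)%N).
Hypotheses (cs : ucycle e s) (s2 : (2 < size s)%N).
Local Notation d := (gdist e c).
Hypotheses (dle : forall v, ((d v).+2 <= n)%N) (ab : a != b)
  (da : (d a).+2 = n) (db : (d b).+2 = n).

Lemma level_pred v : (0 < d v)%N -> exists2 p, e p v & d v = (d p).+1.
Proof.
move=> dv; have [q [cq qv qs]] := gdist_path (con c v).
case/lastP: q cq qv qs => [|q w]; first by move=> _ _ /esym E; rewrite E in dv.
rewrite rcons_path last_rcons size_rcons => /andP[cq qw] wv qs; subst w.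
exists (last c q) => //; apply/eqP; rewrite eqn_leq -{2}qs ltnS gdist_le_path // andbT.
by rewrite (gdistC eC) (gdistC eC c); apply: gdist_edge.
Qed.

(** A shortest path from [a] back to [c] meets every level, and it avoids [b], which is as far from
    [c] as [a]. *)
Lemma level_ex h : (h.+2 <= n)%N -> exists2 v, v != b & d v = h.
Proof.
move=> hn; have [k kE] : exists k, (h + k)%N = d a by exists (d a - h)%N; lia.
elim: k h kE {hn} => [|k IH] h kE; first by exists a; rewrite // -kE addn0.
have [v vb dv] := IH h.+1 ltac:(lia).
have [p _ pE] := level_pred (v := v) ltac:(lia).
exists p; last by lia.
by apply/eqP => pb; have := db; have := da; rewrite -pb; lia.
Qed.

(** The [n - 1] vertices other than [b] cover all [n - 1] levels, so each level contains exactly one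
    of them. *)
Lemma level_inj u v : u != b -> v != b -> d u = d v -> u = v.
Proof.
have n0 : n.-2.+1 = n.-1 by lia.
pose f w : 'I_n.-2.+1 := inord (d w).
have fE w : f w = d w :> nat by rewrite inordK //; have := dle w; lia.
have img : f @: [set~ b] = [set: 'I_n.-2.+1].
  apply/setP => h; rewrite inE; have := ltn_ord h => hn.
  have hn2 : (h.+2 <= n)%N by lia.
  have [w wb dw] := level_ex hn2.
  by apply/imsetP; exists w; rewrite ?inE //; apply: val_inj; rewrite /= fE.
have /imset_injP finj : #|f @: [set~ b]| == #|[set~ b]|.
  by rewrite img cardsT card_ord cardsC1 Tn n0.
by move=> ub vb duv; apply: finj; rewrite ?inE //; apply: val_inj; rewrite /= !fE.
Qed.

Lemma level_edge u v : e u v -> (d v <= (d u).+1)%N.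
Proof.
move=> uv; rewrite (gdistC eC) (gdistC eC c); exact: gdist_edge.
Qed.

(* Otherwise every vertex has at most one neighbour that is not farther from
   [c], which fails for the farthest vertex of a cycle. *)
Lemma twins_adjacent : e a b.
Proof.
apply: contraT => nab.
have nba : ~~ e b a by rewrite eC.
have [m0 m0s] : exists m, m \in s by case: (s) s2 => // m ? _; exists m; rewrite mem_head.
have [m ms mmax] : exists2 m, m \in s & forall v, v \in s -> (d v <= d m)%N.
  by have [m ms mmax] := arg_maxnP d m0s; exists m.
have [i p pE] := rot_to ms.
have psize : (size p).+1 = size s by rewrite -(size_rot i s) pE.
have cp : cycle e (m :: p) by rewrite -pE rot_cycle; case/andP: cs.
have up : uniq (m :: p) by rewrite -pE rot_uniq; case/andP: cs.
have ps v : v \in p -> v \in s by move=> vp; rewrite -(mem_rot i) pE inE vp orbT.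
have nbr v : v \in s -> e m v -> d m = (d v).+1.
  move=> vs mv; have := mmax v vs; have := level_edge (u := v) (v := m).
  rewrite eC mv => /(_ isT) h1 h2.
  suff : d v != d m by move/eqP; lia.
  apply/eqP => E; have [vb|vb] := eqVneq v b.
    have [mb|mb] := eqVneq m b; first by rewrite vb mb eI in mv.
    have ma : m = a by apply: level_inj => //; rewrite -E vb; lia.
    by rewrite vb ma (negbTE nab) in mv.
  have [mb|mb] := eqVneq m b; last by rewrite (level_inj vb mb E) eI in mv.
  have va : v = a by apply: level_inj => //; rewrite E mb; lia.
  by rewrite va mb (negbTE nba) in mv.
have nb v : d m = (d v).+1 -> v != b.
  by move=> h; apply/eqP => vb; have := dle m; rewrite h vb; lia.
case: p pE psize cp up ps => [|u p] pE psize /= cp up ps; first by move: s2; rewrite -psize.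
case/lastP: p pE psize cp up ps => [|p w] pE psize cp up ps; first by move: s2; rewrite -psize.
move: cp; rewrite !rcons_path !last_rcons => /and3P[mu _ wm].
have us : u \in s by apply: ps; rewrite mem_head.
have ws : w \in s by apply: ps; rewrite inE mem_rcons mem_head orbT.
have hu := nbr u us mu; have hw : d m = (d w).+1 by apply: nbr => //; rewrite eC.
have uw : u = w by apply: level_inj; [exact: nb | exact: nb | lia].
by move: up; rewrite uw mem_rcons inE eqxx /= andbF.
Qed.

(* The far end [c] gets the last label, and the twins [a], [b] get 1 and 0. *)
Let F v : nat := if v == b then 0%N else (n.-1 - d v)%N.

Let F_lt v : (F v < n)%N.
Proof. by rewrite /F; case: eqP => _; lia. Qed.

Let F_gt0 v : v != b -> (0 < F v)%N.
Proof. by move=> vb; rewrite /F (negbTE vb); have := dle v; lia. Qed.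

Let F_inj : injective F.
Proof.
move=> u v E; have [ub|ub] := eqVneq u b; have [vb|vb] := eqVneq v b.
- by rewrite ub vb.
- by have := F_gt0 vb; rewrite -E /F ub eqxx.
- by have := F_gt0 ub; rewrite E /F vb eqxx.
apply: level_inj => //; move: E; rewrite /F (negbTE ub) (negbTE vb).
have := dle u; have := dle v; lia.
Qed.

(** Levels change by at most one along an edge, so no edge of [e] is missing from the kite.
    Conversely each vertex other than [c] has a neighbour one level nearer to [c], which [level_inj]
    identifies; the edge between the twins is [twins_adjacent]. *)
Lemma isomorphic_kite : isomorphic e (@kite3 n).
Proof.
pose f v : 'I_n := Ordinal (F_lt v).
have f_inj : injective f by move=> u v /(congr1 val) /= /F_inj.
exists f; first by apply: inj_card_bij f_inj _; rewrite card_ord Tn.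
have kC : symmetric (@kite3 n) := @kite3_sym n.
suff lt u v : (F u < F v)%N -> @kite3 n (f u) (f v) = e u v.
  move=> u v; case: (ltngtP (F u) (F v)) => [|vu|E].
  - exact: lt.
  - by rewrite kC eC lt.
  - by rewrite (F_inj E) eI /kite3 eqxx.
move=> Fuv; have vb : v != b by apply: contraTneq Fuv => ->; rewrite /F eqxx.
have FvE : F v = (n.-1 - d v)%N by rewrite /F (negbTE vb).
have dv := dle v.
have uv : f u != f v by rewrite -val_eqE /=; apply/eqP; lia.
rewrite /kite3 uv /=; apply/idP/idP; last first.
  move=> euv; have h := level_edge euv.
  have h' : (d u <= (d v).+1)%N by apply: level_edge; rewrite eC.
  have [ub|ub] := eqVneq u b.
    have Fu0 : F u = 0%N by rewrite /F ub eqxx.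
    by rewrite Fu0 FvE; move: h'; rewrite ub; lia.
  by move: Fuv h h'; rewrite FvE /F (negbTE ub); lia.
move=> K; have [ub|ub] := eqVneq u b.
  have Fu0 : F u = 0%N by rewrite /F ub eqxx.
  have [va|va] := eqVneq v a; first by rewrite ub va eC twins_adjacent.
  have dva : d v != d a by apply: contraNneq va => E; apply/eqP; apply: level_inj.
  have [p pb dp] := level_pred (v := b) ltac:(lia).
  rewrite ub (_ : v = p) 1?eC //; apply: level_inj => //.
    by apply/eqP => E; rewrite E in dp; lia.
  by move: K dva; rewrite Fu0 FvE; lia.
have FuE : F u = (n.-1 - d u)%N by rewrite /F (negbTE ub).
have du : d u = (d v).+1.
  by have := F_gt0 ub; move: K Fuv; rewrite FuE FvE; have := dle u; lia.
have [p pu dp] := level_pred (v := u) ltac:(lia).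
rewrite (_ : v = p) 1?eC //; apply: level_inj => //; last by lia.
by apply/eqP => E; rewrite E in dp; have := dle u; lia.
Qed.

End KiteRecognition.

(** * Comparison of spectral radii *)

Section Transport.
Variables (R : realType) (T T' : finType) (g : T' -> T).
Hypothesis gB : bijective g.

Lemma sum_setT_bij (F : T -> R) :
  \sum_(t in [set: T]) F t = \sum_(t in [set: T']) F (g t).
Proof.
rewrite (reindex g) /=; last exact: onW_bij.
by apply: eq_bigl => t; rewrite !inE.
Qed.

Lemma sum_bij (F : T -> R) : \sum_t F t = \sum_t F (g t).
Proof. by rewrite (reindex g) //=; exact: onW_bij. Qed.

Lemma triple_form_bij (x : T -> R) :
  triple_form x [set: T] = triple_form (x \o g) [set: T'].
Proof.
rewrite /triple_form sum_setT_bij; apply: eq_bigr => u _.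
rewrite sum_setT_bij; apply: eq_bigr => v _.
by rewrite sum_setT_bij.
Qed.

Lemma dist_form_bij (d : T -> T -> nat) (x : T -> R) :
  dist_form d x [set: T] = dist_form (fun u v => d (g u) (g v)) (x \o g) [set: T'].
Proof.
by rewrite /dist_form sum_setT_bij; apply: eq_bigr => u _; rewrite sum_setT_bij.
Qed.

Lemma kite_loss_bij (x : T -> R) a b :
  kite_loss x [set: T] (g a) (g b) = kite_loss (x \o g) [set: T'] a b.
Proof. by rewrite /kite_loss sum_setT_bij. Qed.

Variables (e : rel T) (e' : rel T').
Hypotheses (eC : symmetric e) (eC' : symmetric e').
Hypotheses (T0 : (0 < #|T|)%N) (T0' : (0 < #|T'|)%N).
Variable x : T -> R.
Hypothesis xe : lap_eigenvector e (dist_lap_radius R e) x.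
Hypothesis x0 : exists t, x t != 0.
Hypothesis form_le :
  dist_form (gdist e) x [set: T] <= dist_form (gdist e') (x \o g) [set: T'].

Lemma radius_le : dist_lap_radius R e <= dist_lap_radius R e'.
Proof.
have [t xt] := x0; have S0 := sum_sqr_gt0 xt.
have := dist_form_le_radius eC' T0' (x \o g); rewrite -(sum_bij (fun t => x t ^+ 2)).
move: form_le; rewrite (dist_form_eigenvector eC xe) => h1 h2.
have := le_trans h1 h2; rewrite ler_pM2r // ler_pM2l //.
Qed.

Lemma radius_eq_eigenvector : dist_lap_radius R e = dist_lap_radius R e' ->
  lap_eigenvector e' (dist_lap_radius R e') (x \o g).
Proof.
move=> E; apply: radius_eigenvector eC' T0' _ _; apply/eqP.
rewrite eq_le dist_form_le_radius //= -E.
by rewrite -(sum_bij (fun t => x t ^+ 2)) -(dist_form_eigenvector eC xe).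
Qed.

End Transport.

Lemma isomorphic_sym (T T' : finType) (e : rel T) (e' : rel T') :
  isomorphic e e' -> isomorphic e' e.
Proof.
case=> f [h fK hK] fe; exists h; first by exists f.
by move=> x y; rewrite -fe !hK.
Qed.

Lemma isomorphic_radius_le (R : realType) (T T' : finType) (e : rel T) (e' : rel T') :
    symmetric e -> symmetric e' -> (0 < #|T|)%N -> (forall u v, connect e' u v) ->
  isomorphic e e' -> dist_lap_radius R e <= dist_lap_radius R e'.
Proof.
move=> eC eC' T0 con' [f [h fK hK] fe].
have T0' : (0 < #|T'|)%N.
  by have [t _] := card_gt0P T0; apply/card_gt0P; exists (f t).
have [x xe x0] := eigenvector_ex R eC T0.
apply: (@radius_le R T T' h _ e e') xe x0 _ => //; first by exists f.
rewrite (@dist_form_bij R T T' h); last by exists f.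
apply: ler_sum => u _; apply: ler_sum => v _.
rewrite ler_wpM2r ?sqd_ge0 // ler_nat; apply: gdist_hom => // a b ab.
by rewrite -fe !hK.
Qed.

Lemma sorting_ex (R : realType) (T : finType) (x : T -> R) : (0 < #|T|)%N ->
  exists2 f : 'I_#|T| -> T, bijective f &
    forall i j : 'I_#|T|, (i <= j)%N -> x (f i) <= x (f j).
Proof.
move=> T0; pose r u v := x u <= x v; pose s := sort r (enum T).
have sz : size s = #|T| by rewrite size_sort -cardE.
have us : uniq s by rewrite sort_uniq enum_uniq.
have rT : transitive r by move=> ? ? ?; exact: le_trans.
have ss : sorted r s by apply: sort_sorted => u v; exact: le_total.
have [t0 _] := card_gt0P T0.
exists (fun i : 'I_#|T| => nth t0 s i).
  apply: inj_card_bij; last by rewrite card_ord.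
  move=> i j /eqP; rewrite nth_uniq ?sz ?ltn_ord // => /eqP; exact: val_inj.
move=> i j ij; apply: (sorted_leq_nth rT _ t0 ss) => //; rewrite ?inE ?sz ?ltn_ord //.
by move=> u; exact: lexx.
Qed.

(** * The inequality and the case of equality *)

Section Extremal.
Variables (R : realType) (T : finType) (e : rel T) (s : seq T).
Hypotheses (eC : symmetric e) (eI : irreflexive e) (con : forall u v, connect e u v).
Hypotheses (T3 : (2 < #|T|)%N) (cs : ucycle e s) (s2 : (2 < size s)%N).
Local Notation n := #|T|.
Local Notation k3 := (@kite3 n).
Local Notation lam := (dist_lap_radius R e).

Let T0 : (0 < #|T|)%N := ltnW (ltnW T3).
Let kT0 : (0 < #|{: 'I_n}|)%N. Proof. by rewrite card_ord. Qed.
Let kC : symmetric k3 := @kite3_sym n.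

Let KL : kite_like R (gdist e) [set: T].
Proof.
apply: (@kite_like_connected R T (gdist e) _ _ e) con cs s2 => //.
- exact: gdistC.
- exact: gdist_xx.
- by move=> u z v; exact: gdist_edge.
Qed.

Let i0 : 'I_n := Ordinal (ltnW (ltnW T3)).
Let i1 : 'I_n := Ordinal (ltnW T3).

(** The eigenvector is negated if its loss is at the top. On the sorted vertices the triple form is
    three times the form of the path, so the kite bound becomes a comparison with the kite. *)
Lemma sorted_eigenvector_ex : exists x (f : 'I_n -> T),
  [/\ lap_eigenvector e lam x, exists t, x t != 0, bijective f,
      forall i j : 'I_n, (i <= j)%N -> x (f i) <= x (f j) &
      dist_form (gdist e) x [set: T] <= dist_form (gdist k3) (x \o f) [set: 'I_n]].
Proof.
have [x xe [t xt]] := eigenvector_ex R eC T0; have [_ _ _ KB] := KL.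
have main z a b : lap_eigenvector e lam z -> (exists t, z t != 0) ->
    lowest z [set: T] a b ->
    3 * dist_form (gdist e) z [set: T] + 6 * kite_loss z [set: T] a b
      <= triple_form z [set: T] ->
    exists x (f : 'I_n -> T),
  [/\ lap_eigenvector e lam x, exists t, x t != 0, bijective f,
      forall i j : 'I_n, (i <= j)%N -> x (f i) <= x (f j) &
      dist_form (gdist e) x [set: T] <= dist_form (gdist k3) (x \o f) [set: 'I_n]].
  move=> ze z0 l h; have [f fB fmono] := sorting_ex z T0.
  exists z, f; split=> //; have [g fK gK] := fB.
  have lf : lowest z [set: T] (f i0) (f i1).
    split; rewrite ?inE ?(inj_eq (bij_inj fB)) ?fmono // => v _ v0.
    rewrite -(gK v) fmono //= lt0n; apply: contraNneq v0 => g0.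
    by rewrite -(gK v); apply/eqP; congr f; apply: val_inj.
  move: h; rewrite (kite_loss_lowest l lf) (triple_form_bij fB) (kite_loss_bij fB).
  rewrite -(initial_full n) (triple_form_sorted (leqnn n)) //.
  by rewrite initial_full (line_le_kite T3); lra.
have [a [b [[l|l] h]]] := KB x; first exact: main xe (ex_intro _ t xt) l h.
apply: (main (\- x) a b) => //; first exact: lap_eigenvectorN.
  by exists t; rewrite oppr_eq0.
by rewrite dist_formN triple_formN kite_lossN.
Qed.

Lemma radius_le_kite : lam <= dist_lap_radius R k3.
Proof.
have [x [f [xe x0 fB _ le]]] := sorted_eigenvector_ex.
exact: (radius_le fB eC kC kT0 xe x0 le).
Qed.

Let last_lt : (n.-1 < n)%N. Proof. by rewrite prednK. Qed.

Let l : 'I_n := Ordinal last_lt.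

Lemma radius_eq_kite : lam = dist_lap_radius R k3 -> isomorphic e k3.
Proof.
move=> E; have [x [f [xe x0 fB fmono le]]] := sorted_eigenvector_ex.
have ye := radius_eq_eigenvector fB eC kC kT0 xe le E; rewrite -E in ye.
have [_ dV stV _] := KL.
have f_inj := bij_inj fB; have [g fK gK] := fB.
pose c := f l; have lE : l = n.-1 :> nat by [].
have dle v : ((gdist e c v).+2 <= n)%N.
  by have := dV c v (finset.in_setT _) (finset.in_setT _); rewrite cardsT.
(* Each of the two distances is at most [n - 2] by [dle], so a sum of at least [2 * (n - 2)]
   determines both. *)
suff h : (2 * n <= gdist e c (f i0) + gdist e c (f i1) + 4)%N.
  apply: (@isomorphic_kite n T e (f i0) (f i1) c s) => //.
  - by rewrite (inj_eq f_inj).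
  - by have := dle (f i0); have := dle (f i1); lia.
  - by have := dle (f i0); have := dle (f i1); lia.
have cneq (i : 'I_n) : (i < n.-1)%N -> c != f i.
  by move=> il; rewrite (inj_eq f_inj) -val_eqE /= gtn_eqF.
have c0 : c != f i0 by apply: cneq; move: T3 => /=; lia.
have c1 : c != f i1 by apply: cneq; move: T3 => /=; lia.
have [n3|n4] := leqP n 3.
  by have := gdist_gt0 e c0; have := gdist_gt0 e c1; move: n3; lia.
pose i2 : 'I_n := Ordinal T3.
have lam0 : lam != 0.
  have [t xt] := x0.
  rewrite gt_eqF //; have := dist_form_le_radius eC T0 (fun t => (t == c)%:R : R).
  have -> : \sum_t ((t == c)%:R : R) ^+ 2 = 1.
    by rewrite (bigD1 c) //= eqxx expr1n big1 ?addr0 // => v /negbTE->; rewrite expr0n.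
  have : 0 < dist_form (gdist e) (fun t => (t == c)%:R : R) [set: T].
    rewrite /dist_form (bigD1 c) ?inE //= (bigD1 (f i0)) ?inE //= -addrA.
    apply: ltr_pwDl.
      rewrite /sqd eqxx (eq_sym (f i0)) (negbTE c0) subr0.
      by rewrite expr1n mulr1 ltr0n gdist_gt0.
    by apply: addr_ge0; do ?[apply: sumr_ge0 => *]; rewrite mulr_ge0 ?ler0n ?sqd_ge0.
  lra.
have y12 : x (f i1) < x (f i2).
  apply: (@kite_eigenvector_lt R n lam (x \o f) n4 fmono ye i1 i2) => //.
  by have [t xt] := x0; exists (g t); rewrite /= gK.
(* Lowering the two largest coordinates isolates the two distances sought. *)
pose eps := x (f i2) - x (f i1).
pose Y (v : T) := x c - x v - eps * ((v == f i0) || (v == f i1))%:R.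
have YE (i : 'I_n) : Y (f i) = x c - x (f i) - eps * (i < 2)%:R.
  by rewrite /Y !(inj_eq f_inj) -!val_eqE /=; case: (i : nat) => [|[|k]].
have fc (i : 'I_n) : x (f i) <= x c by apply: fmono; have := ltn_ord i; rewrite lE; lia.
have f1 (i : 'I_n) : (i < 2)%N -> x (f i) <= x (f i1) by move=> h; apply: fmono; rewrite -ltnS.
have f2 (i : 'I_n) : (1 < i)%N -> x (f i2) <= x (f i) by move=> h; apply: fmono.
have eps0 : 0 < eps by rewrite subr_gt0.
have Y0 v : 0 <= Y v.
  rewrite -(gK v) YE; have := fc (g v); have := fc i2.
  case: ltnP => [/f1|_]; rewrite ?mulr1 ?mulr0 /eps; lra.
have Yc : Y c = 0.
  by rewrite YE ltnNge lE (_ : (1 < n.-1)%N) ?mulr0 ?subrr ?subr0 //; lia.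
(* The choice of [eps] makes [Y (f i1)] equal to [Y (f i2)], so the order survives the lowering. *)
have anti : forall i j : 'I_n, (i <= j)%N -> (Y \o f) j <= (Y \o f) i.
  move=> i j ij; rewrite /= !YE; have := fmono i j ij.
  have [i_2|i_2] := ltnP i 2; have [j_2|j_2] := ltnP j 2;
    rewrite ?mulr1 ?mulr0 ?subr0 /eps.
  - lra.
  - by have := f1 i i_2; have := f2 j j_2; lra.
  - by have := leq_trans i_2 ij; rewrite leqNgt j_2.
  - lra.
(* The star bound of [e] at [c] meets the equality of the kite: the sum of [Y] weighted by the
   distances from [c] is at most the corresponding sum for the kite. *)
have := stV c (finset.in_setT _) Y (f i0) Y0 Yc (finset.in_setT _).
rewrite (sum_setT_bij fB) (sum_setT_bij fB Y) [leRHS](sum_setT_bij fB).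
under [leRHS]eq_bigr do rewrite (sum_setT_bij fB).
rewrite (sum_max_kite T3 lE anti) mulr1 => starE.
have split_sum (F : 'I_n -> R) (D : 'I_n -> nat) : (forall i, F i = Y (f i) + eps * (i < 2)%:R) ->
    \sum_i (D i)%:R * F i =
    \sum_(i in [set: 'I_n]) (D i)%:R * Y (f i) + eps * ((D i0)%:R + (D i1)%:R).
  move=> FE; under eq_bigr => i _ do rewrite FE mulrDr.
  rewrite big_split /=; congr (_ + _); first by apply: eq_bigl => i; rewrite inE.
  rewrite (bigD1 i0) //= (bigD1 i1) //= big1 ?addr0 => [|i /andP[]].
    by ring.
  move=> h0 h1; have i_2 : (1 < i)%N by move: h0 h1; rewrite -!val_eqE /=; lia.
  by rewrite ltnNge i_2 !mulr0.
have := xe c; rewrite (sum_bij fB) (split_sum _ (fun i => gdist e c (f i))) => [eE|i]; last first.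
  by rewrite YE subrK.
have := ye l; rewrite (split_sum _ (gdist k3 l)) => [kE|i]; last by rewrite YE subrK.
have l1 : (1 < l)%N by move: n4; rewrite lE; lia.
have kI (i : 'I_n) : (i < 2)%N -> gdist k3 l i = n.-2.
  move=> i_2; rewrite (gdistC kC); have [i_0|i_0] := posnP i.
    by rewrite kite_gdist0 // lE.
  rewrite kite_gdistE // ?lE; last by move: l1; rewrite lE; lia.
  by rewrite (_ : i = 1 :> nat)%N ?subn1 //; lia.
rewrite !kI // in kE.
(* Both eigenvalue equations have the same right-hand side [lam * x c], so the smaller sum of [Y]
   for [e] must be made up by the [eps] terms. *)
have : eps * (n.-2%:R + n.-2%:R) <= eps * ((gdist e c (f i0))%:R + (gdist e c (f i1))%:R).
  move: starE; rewrite !lerD2r ler_pM2l // => AB.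
  rewrite -(lerD2l (\sum_(i in [set: 'I_n]) (gdist e c (f i))%:R * Y (f i))) eE.
  by rewrite (esym kE : lam * x c = _) lerD2r.
rewrite ler_pM2l // -!natrD ler_nat; lia.
Qed.

End Extremal.

Theorem theorem3p1 (R : realType) (n : nat) (T : finType) (e : rel T) :
  simple_graph e -> unicyclic e -> #|T| = n -> (3 <= n)%N ->
  dist_lap_radius R e <= dist_lap_radius R (@kite3 n) /\
  (dist_lap_radius R e = dist_lap_radius R (@kite3 n) <->
   isomorphic e (@kite3 n)).
Proof.
case=> eC eI [[T0 con] [C [[s [cs s2 _]] _]]] <- T3.
split; first exact: (radius_le_kite R eC con T3 cs s2).
split; first exact: (radius_eq_kite eC eI con T3 cs s2).
have kC := @kite3_sym #|T|; have kT0 : (0 < #|{: 'I_#|T|}|)%N by rewrite card_ord.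
move=> iso; apply/eqP; rewrite eq_le; apply/andP; split.
  exact: (isomorphic_radius_le R eC kC T0 (kite_connect T3) iso).
exact: (isomorphic_radius_le R kC eC kT0 con (isomorphic_sym iso)).
Qed.
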